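(* Let $(X,\mathcal{B},\mu)$ be a probability space. There exists a constant $0<\delta<1$ such that for all measure preserving transformations $T_1,T_2,T_3$ of $(X,\mathcal{B},\mu)$ (so $\delta$ is independent of the $T_i$) and every measurable set $A\in\mathcal{B}$ with $\mu(A)>1-\delta$, the following limit exists and satisfies $$\lim_{N\to\infty}\frac{1}{N^2}\sum_{n,m=1}^N \mu\big(A\cap T_1^{-n}A\cap T_2^{-m}A\cap T_3^{-n-m}A\big)\geq \frac{1}{2}\,\mu(A)^8 .$$
   Context: The transformations $T_1,T_2,T_3$ are not assumed to commute. $T^{-n}A$ denotes the preimage $\{x: T^n x\in A\}$. *)

(* Defs.v *)
From HB Require Import structures.
From mathcomp Require Export all_boot all_order all_algebra.
From mathcomp Require Export all_classical all_reals all_analysis.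
Export Order.TTheory GRing.Theory Num.Theory.
Export numFieldNormedType.Exports.

Set Implicit Arguments.
Unset Strict Implicit.
Unset Printing Implicit Defensive.

Local Open Scope classical_set_scope.
Local Open Scope ring_scope.

(* Invertibility is not required. *)
Definition measure_preserving (R : realType) (d : measure_display)
    (X : measurableType d) (mu : {measure set X -> \bar R}) (T : X -> X) : Prop :=
  measurable_fun [set: X] T /\
  (forall A : set X, measurable A -> mu (T @^-1` A) = mu A).

(* Main.v *)
Require Import Defs.
From mathcomp Require Import all_boot all_order all_algebra.
From mathcomp Require Import all_classical all_reals all_analysis.
From mathcomp Require Import ring lra.
Import Order.TTheory GRing.Theory Num.Theory.
Import numFieldNormedType.Exports.
Import measurable_realfun.

Set Implicit Arguments.
Unset Strict Implicit.

Local Open Scope classical_set_scope.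
Local Open Scope ring_scope.

(* With delta = 1/8 every term of the average is at least 1/2, so the point is the
   existence of the limit.  Fix x and read off the 0-1 words a_n, b_m, c_k of the
   visits to A of its three orbits.  By finite Fourier analysis,
   N^-2 \sum_(n, m) a_n b_m c_(n+m) hardly changes when one of the words is altered
   by a sequence without large Fourier coefficients on [0, N) (or [0, 2N) for c), and
   it converges when the three words are finite trigonometric sums.

   It remains to approximate a word by one trigonometric sum simultaneously at all
   scales.  Let D(J, N) be the squared l^2 distance on [0, N) from the word to the
   sums of J waves.  It is superadditive in N, so its mean over x is asymptotically
   rho(J) N by stationarity, and rho(J) - rho(J + 1) is small for some J.  At every
   large scale, for most x, adding one more wave to a nearly optimal fit does not
   help, so the remainder has small Fourier coefficients.  Restricting a nearly
   optimal fit on a very long interval [0, M) to windows, and averaging over the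
   starting points of the windows, shows that for most x one and the same sum is
   nearly optimal at arbitrarily many prescribed scales; compactness of the set of
   trigonometric sums handles infinitely many scales.

   If the averages were not Cauchy, pairs of scales with distant averages would give
   sets of measure bounded below; a point lying in infinitely many of them, and in
   the good sets, contradicts the convergence for trigonometric sums. *)

(** * Finite Fourier analysis *)

Section Fourier.
Variable R : realType.
Implicit Types (x y z : nat -> R) (t : R) (N Q : nat).

(** The Fourier sum of [x] is kept as its real and imaginary parts, so that every quantity stays in
    [R]. *)
Definition cos_coef N x t : R := \sum_(k < N) x k * cos (t *+ k).
Definition sin_coef N x t : R := \sum_(k < N) x k * sin (t *+ k).
Definition energy N x : R := \sum_(k < N) x k ^+ 2.
Definition trisum N x y z : R :=
  \sum_(n < N) \sum_(m < N) x n * y m * z (n + m)%N.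

(** By product-to-sum, each term times [2 sin (u / 2)] is a difference of consecutive values of
    [sin (u k + w - u / 2)]. Multiplying instead of dividing avoids a condition on [u]. *)
Lemma sum_cos_telescope n u w :
  (\sum_(k < n) cos (u *+ k + w)) * (2 * sin (u / 2)) =
  sin (u *+ n + w - u / 2) - sin (w - u / 2) :> R.
Proof.
elim: n => [|n IH]; first by rewrite big_ord0 mul0r mulr0n add0r subrr.
rewrite big_ord_recr /= mulrDl IH.
have -> : u *+ n.+1 + w - u / 2 = (u *+ n + w) + u / 2.
  rewrite mulrSr; move: (u *+ n) (splitr u) => a.
  by move: (u / 2) => h ->; ring.
by rewrite (sinB (u *+ n + w)) (sinD (u *+ n + w)); ring.
Qed.

Lemma sin_gt0_bounded (k Q : nat) : (0 < k < Q)%N ->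
  0 < sin (pi *+ k / Q%:R) :> R.
Proof.
move=> /andP[k0 kQ]; apply: sin_gt0_pi.
have Q0 : 0 < Q%:R :> R by rewrite ltr0n (leq_trans k0 (ltnW kQ)).
apply/andP; split; first by rewrite divr_gt0 // pmulrn_lgt0 // pi_gt0.
by rewrite ltr_pdivrMr // -[pi *+ k]mulr_natr ltr_pM2l ?pi_gt0 // ltr_nat.
Qed.

(** Half the step, [pi (a - b) / Q], lies strictly between 0 and pi, so its sine can be cancelled;
    over a full period the telescoped difference vanishes. *)
Lemma cos_orthogonal_lt (a b Q : nat) : (b < a < Q)%N ->
  \sum_(i < Q) cos (pi *+ 2 *+ i / Q%:R *+ a - pi *+ 2 *+ i / Q%:R *+ b) = 0 :> R.
Proof.
move=> /andP[ba aQ].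
have Q0 : Q%:R != 0 :> R by rewrite pnatr_eq0; case: Q aQ.
set u : R := pi *+ 2 *+ (a - b) / Q%:R.
have su : 2 * sin (u / 2) != 0.
  rewrite mulf_neq0 //; apply: lt0r_neq0.
  have -> : u / 2 = pi *+ (a - b) / Q%:R.
    by rewrite /u -mulrnA mulnC mulrnA -mulr_natr; field.
  by apply: sin_gt0_bounded; rewrite subn_gt0 ba (leq_ltn_trans (leq_subr _ _) aQ).
apply: (mulIf su); rewrite mul0r.
rewrite (eq_bigr (fun i : 'I_Q => cos (u *+ i + 0))); last first.
  move=> i _; congr cos; rewrite /u addr0 -mulrnBr ?(ltnW ba) //.
  by move: (pi *+ 2) => p; rewrite !mulrnAl mulrnAC.
rewrite sum_cos_telescope addr0 add0r.
have -> : u *+ Q - u / 2 = - (u / 2) + pi *+ 2 *+ (a - b).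
  by rewrite addrC -[u *+ Q]mulr_natr {2}/u mulfVK.
by rewrite (periodicn (@sinD2pi R)) subrr.
Qed.

Lemma cos_orthogonal (a b Q : nat) : (a < Q)%N -> (b < Q)%N ->
  \sum_(i < Q) cos (pi *+ 2 *+ i / Q%:R *+ a - pi *+ 2 *+ i / Q%:R *+ b) =
  Q%:R *+ (a == b) :> R.
Proof.
move=> aQ bQ; case: (ltngtP a b) => [ab|ba|->] /=.
- under eq_bigr do rewrite -cosN opprB.
  by rewrite cos_orthogonal_lt ?ab.
- by rewrite cos_orthogonal_lt ?ba.
- under eq_bigr do rewrite subrr cos0.
  by rewrite sumr_const card_ord.
Qed.

(** Orthogonality only asks for indices below [Q], so the same 2N frequencies treat sequences of
    length N and of length 2N. *)
Lemma parseval N Q x : (N <= Q)%N ->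
  \sum_(i < Q) (cos_coef N x (pi *+ 2 *+ i / Q%:R) ^+ 2 +
                sin_coef N x (pi *+ 2 *+ i / Q%:R) ^+ 2) = Q%:R * energy N x.
Proof.
move=> NQ; pose t (i : 'I_Q) : R := pi *+ 2 *+ i / Q%:R.
transitivity (\sum_(i < Q) \sum_(n < N) \sum_(m < N)
    x n * x m * cos (t i *+ n - t i *+ m)).
  apply: eq_bigr => i _; rewrite !expr2 !big_distrlr -big_split /=.
  apply: eq_bigr => n _; rewrite -big_split /=.
  by apply: eq_bigr => m _; rewrite cosB /t; ring.
rewrite exchange_big mulr_sumr; apply: eq_bigr => n _.
rewrite exchange_big (bigD1 n) //= [X in _ + X]big1 ?addr0.
  rewrite -mulr_sumr cos_orthogonal ?(leq_trans (ltn_ord _)) // eqxx.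
  by rewrite mulrC expr2.
move=> m mn; rewrite -mulr_sumr cos_orthogonal ?(leq_trans (ltn_ord _)) //.
by rewrite (_ : (n == m :> nat) = false) ?mulr0 // eq_sym; apply/negbTE.
Qed.

(* With Q = 2N the congruence n + m = k mod Q forces n + m = k. *)
Lemma trisum_fourier N x y z (Q := N.*2) :
  Q%:R * trisum N x y z = \sum_(i < Q)
    let t := pi *+ 2 *+ i / Q%:R in
    ((cos_coef N x t * cos_coef N y t - sin_coef N x t * sin_coef N y t)
       * cos_coef Q z t +
     (sin_coef N x t * cos_coef N y t + cos_coef N x t * sin_coef N y t)
       * sin_coef Q z t).
Proof.
pose t (i : 'I_Q) : R := pi *+ 2 *+ i / Q%:R.
transitivity (\sum_(i < Q) \sum_(n < N) \sum_(m < N) \sum_(k < Q)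
    x n * y m * z k * cos (t i *+ (n + m) - t i *+ k)).
  rewrite exchange_big mulr_sumr; apply: eq_bigr => n _.
  rewrite exchange_big mulr_sumr; apply: eq_bigr => m _.
  have nmQ : (n + m < Q)%N.
    by rewrite /Q -addnn -addSn leq_add // ltnW.
  rewrite exchange_big (bigD1 (Ordinal nmQ)) //= [X in _ + X]big1 ?addr0.
    by rewrite -mulr_sumr cos_orthogonal // eqxx mulrC.
  move=> k kn; rewrite -mulr_sumr cos_orthogonal //.
  by rewrite (_ : (_ == k :> nat) = false) ?mulr0 // eq_sym; apply/negbTE.
apply: eq_bigr => i _ /=; rewrite -/(t i).
rewrite /cos_coef /sin_coef !big_distrlr -sumrB -big_split /= !mulr_suml -big_split /=.
apply: eq_bigr => n _; rewrite -sumrB -big_split /= !mulr_suml -big_split /=.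
apply: eq_bigr => m _; rewrite !mulr_sumr -big_split /=.
by apply: eq_bigr => k _; rewrite mulrnDr cosB cosD sinD; ring.
Qed.

Lemma norm_mul_le_sqr (a b c U : R) : `|a| <= U ->
  `|a * b * c| <= U * ((b ^+ 2 + c ^+ 2) / 2).
Proof.
move=> aU; rewrite -mulrA normrM ler_pM //.
rewrite normrM -[b ^+ 2]real_normK ?num_real // -[c ^+ 2]real_normK ?num_real //.
by rewrite ler_pdivlMr //; have := sqr_ge0 (`|b| - `|c|); nra.
Qed.

(** All real frequencies are included, so the bound is independent of the grid used by
    [trisum_fourier]. The closed range is that of the waves in [trigsum]. *)
Definition small_coef N x (U : R) := forall t, 0 <= t <= pi *+ 2 ->
  `|cos_coef N x t| <= U /\ `|sin_coef N x t| <= U.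

Lemma fourier_freq_bound Q (i : 'I_Q) : 0 <= (pi : R) *+ 2 *+ i / Q%:R <= pi *+ 2.
Proof.
have Q0 : 0 < Q%:R :> R by rewrite ltr0n; case: Q i => [[]|].
have pp : 0 <= pi *+ 2 :> R by rewrite mulrn_wge0 // pi_ge0.
apply/andP; split; first by rewrite divr_ge0 ?(ltW Q0) // mulrn_wge0.
by rewrite ler_pdivrMr // -[X in X <= _]mulr_natr ler_wpM2l // ler_nat ltnW.
Qed.

(** A bound at each frequency by the squared moduli of two transforms sums, by Parseval, to the two
    energies, and the factor 2N cancels. The lengths [M] and [M'] are free because the sequences
    kept may have length N or 2N. *)
Lemma trisum_le N x y z (f g : nat -> R) (U : R) (M M' : nat) :
    (0 < N)%N -> (M <= N.*2)%N -> (M' <= N.*2)%N ->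
  (forall t, 0 <= t <= pi *+ 2 ->
    `|(cos_coef N x t * cos_coef N y t - sin_coef N x t * sin_coef N y t)
       * cos_coef N.*2 z t +
     (sin_coef N x t * cos_coef N y t + cos_coef N x t * sin_coef N y t)
       * sin_coef N.*2 z t| <=
    U * ((cos_coef M f t ^+ 2 + sin_coef M f t ^+ 2) +
         (cos_coef M' g t ^+ 2 + sin_coef M' g t ^+ 2))) ->
  `|trisum N x y z| <= U * (energy M f + energy M' g).
Proof.
move=> N0 MN MN' H.
have Q0 : 0 < N.*2%:R :> R by rewrite ltr0n double_gt0.
rewrite -(ler_pM2l Q0) -[X in X * `|_|]gtr0_norm // -normrM trisum_fourier.
apply: le_trans (ler_norm_sum _ _ _) _.
pose e t := U * ((cos_coef M f t ^+ 2 + sin_coef M f t ^+ 2) +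
                 (cos_coef M' g t ^+ 2 + sin_coef M' g t ^+ 2)).
apply: (@le_trans _ _ (\sum_(i < N.*2) e (pi *+ 2 *+ i / N.*2%:R))).
  by apply: ler_sum => i _; apply: H; exact: fourier_freq_bound.
by rewrite -mulr_sumr big_split /= !parseval // le_eqVlt; apply/orP; left; apply/eqP; ring.
Qed.

(** The left side is the real part of X Y conj(Z). In each of its four real products the factor
    coming from X is bounded by [U] and the other two are separated by the arithmetic-geometric
    inequality. *)
Lemma four_terms_le (xc xs yc ys zc zs U : R) : `|xc| <= U -> `|xs| <= U ->
  `|(xc * yc - xs * ys) * zc + (xs * yc + xc * ys) * zs| <=
  U * ((yc ^+ 2 + ys ^+ 2) + (zc ^+ 2 + zs ^+ 2)).
Proof.
move=> c s.
have -> : (xc * yc - xs * ys) * zc + (xs * yc + xc * ys) * zs =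
  xc * yc * zc - xs * ys * zc + xs * yc * zs + xc * ys * zs by ring.
have := norm_mul_le_sqr yc zc c; have := norm_mul_le_sqr ys zc s.
have := norm_mul_le_sqr yc zs s; have := norm_mul_le_sqr ys zs c.
rewrite !ler_norml => /andP[? ?] /andP[? ?] /andP[? ?] /andP[? ?].
apply/andP; split; lra.
Qed.

Lemma trisum_le1 N x y z U : (0 < N)%N -> small_coef N x U ->
  `|trisum N x y z| <= U * (energy N y + energy N.*2 z).
Proof.
move=> N0 H; apply: trisum_le => // [|t /H[c s]]; first by rewrite -addnn leq_addr.
exact: four_terms_le.
Qed.

Lemma trisum_le2 N x y z U : (0 < N)%N -> small_coef N y U ->
  `|trisum N x y z| <= U * (energy N x + energy N.*2 z).
Proof.
move=> N0 H; apply: trisum_le => // [|t /H[c s]]; first by rewrite -addnn leq_addr.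
have := @four_terms_le _ _ (cos_coef N x t) (sin_coef N x t)
  (cos_coef N.*2 z t) (sin_coef N.*2 z t) _ c s.
by congr (`|_| <= _); ring.
Qed.

Lemma trisum_le3 N x y z U : (0 < N)%N -> small_coef N.*2 z U ->
  `|trisum N x y z| <= U * (energy N x + energy N y).
Proof.
move=> N0 H; have NN : (N <= N.*2)%N by rewrite -addnn leq_addr.
apply: trisum_le => // t /H[c s].
(* Re(X Y conj(Z)) is read as Re(conj(Z) X conj(conj(Y))): conj(Z) becomes the small factor, and the
   sines of Z and Y change sign. *)
have := @four_terms_le _ (- sin_coef N.*2 z t) (cos_coef N x t) (sin_coef N x t)
  (cos_coef N y t) (- sin_coef N y t) U c.
by rewrite normrN sqrrN => /(_ s); congr (`|_| <= _); ring.
Qed.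

End Fourier.

(** * Averages of trigonometric sums *)

Section TrigSums.
Variable R : realType.
Implicit Types (a b c s : nat -> R) (t : R) (N : nat).

(* Convergence of [u N / N ^ 2] with rate O(1/N), in a form stable under linear
   combinations. *)
Definition quadratic_growth (u : nat -> R) :=
  exists l C : R, forall N, `|u N - l * N%:R ^+ 2| <= C * N%:R.

Lemma quadratic_growthD u v : quadratic_growth u -> quadratic_growth v ->
  quadratic_growth (u \+ v).
Proof.
move=> [l [C H]] [l' [C' H']]; exists (l + l'), (C + C') => N /=.
rewrite !mulrDl (le_trans _ (lerD (H N) (H' N))) //.
by rewrite (le_trans _ (ler_normD _ _)) // le_eqVlt opprD addrACA eqxx.
Qed.

Lemma quadratic_growthZ k u : quadratic_growth u ->
  quadratic_growth (fun N => k * u N).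
Proof.
move=> [l [C H]]; exists (k * l), (`|k| * C) => N.
by rewrite -!mulrA -mulrBr normrM ler_wpM2l.
Qed.

Lemma trisumDl N a a' b c :
  trisum N (a \+ a') b c = trisum N a b c + trisum N a' b c.
Proof.
rewrite /trisum -big_split; apply: eq_bigr => n _ /=.
by rewrite -big_split; apply: eq_bigr => m _ /=; rewrite !mulrDl.
Qed.

Lemma trisumDm N a b b' c :
  trisum N a (b \+ b') c = trisum N a b c + trisum N a b' c.
Proof.
rewrite /trisum -big_split; apply: eq_bigr => n _ /=.
by rewrite -big_split; apply: eq_bigr => m _ /=; rewrite mulrDr mulrDl.
Qed.

Lemma trisumDr N a b c c' :
  trisum N a b (c \+ c') = trisum N a b c + trisum N a b c'.
Proof.
rewrite /trisum -big_split; apply: eq_bigr => n _ /=.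
by rewrite -big_split; apply: eq_bigr => m _ /=; rewrite mulrDr.
Qed.

Lemma trisumZ3 N k k' k'' a b c :
  trisum N (fun n => k * a n) (fun n => k' * b n) (fun n => k'' * c n) =
  k * k' * k'' * trisum N a b c.
Proof.
rewrite /trisum mulr_sumr; apply: eq_bigr => n _.
by rewrite mulr_sumr; apply: eq_bigr => m _; ring.
Qed.

Lemma sum_cos_bounded u w : sin (u / 2) != 0 -> forall N,
  `|\sum_(k < N) cos (u *+ k + w)| <= `|sin (u / 2)|^-1 :> R.
Proof.
move=> su N; rewrite -div1r ler_pdivlMr ?normr_gt0 //.
rewrite -(ler_pM2r (ltr0n R 2)) mul1r -mulrA [X in _ * X]mulrC.
rewrite -[X in _ * (X * _)](@ger0_norm R 2) // -!normrM sum_cos_telescope.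
rewrite (le_trans (ler_normB _ _)) // (natrD _ 1 1) lerD ?sin_max //.
Qed.

(** The hypothesis encodes that [u] is a multiple of 2 pi; the double-angle formulas turn it into
    [cos u = 1] and [sin u = 0]. *)
Lemma sum_cos_constant u w : sin (u / 2) = 0 -> forall k : nat,
  cos (u *+ k + w) = cos w :> R.
Proof.
move=> su.
have u2 : u = u / 2 + u / 2 by exact: splitr.
have cu : cos u = 1.
  by rewrite u2 cosD su mulr0 subr0 -expr2 cos2sin2 su expr0n subr0.
have sinu : sin u = 0 by rewrite u2 sinD su mulr0 mul0r addr0.
elim=> [|k IH]; first by rewrite mulr0n add0r.
by rewrite mulrS -addrA cosD cu sinu mul1r mul0r subr0.
Qed.

(** If one of the two frequencies is not a multiple of 2 pi, the sum in that variable is bounded and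
    the double sum is O(N). Otherwise every term is [cos w]. *)
Lemma quadratic_growth_cos u v w : quadratic_growth (fun N =>
  \sum_(n < N) \sum_(m < N) cos (u *+ n + (v *+ m + w))).
Proof.
have norm_sum_const N (f : nat -> R) C : (forall k, `|f k| <= C) ->
    `|\sum_(k < N) f k| <= C * N%:R.
  move=> H; rewrite (le_trans (ler_norm_sum _ _ _)) //.
  rewrite mulr_natr -[X in _ *+ X]card_ord -sumr_const.
  by apply: ler_sum => i _; exact: H.
have [su|su] := eqVneq (sin (u / 2)) 0; last first.
  exists 0, `|sin (u / 2)|^-1 => N; rewrite mul0r subr0 exchange_big /=.
  apply: (norm_sum_const N (fun m => \sum_(n < N) cos (u *+ n + (v *+ m + w)))).
  by move=> m; exact: sum_cos_bounded.
have [sv|sv] := eqVneq (sin (v / 2)) 0; last first.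
  exists 0, `|sin (v / 2)|^-1 => N; rewrite mul0r subr0.
  apply: (norm_sum_const N (fun n => \sum_(m < N) cos (u *+ n + (v *+ m + w)))).
  move=> n; under eq_bigr do rewrite sum_cos_constant //.
  exact: sum_cos_bounded.
exists (cos w), 0 => N; rewrite mul0r.
under eq_bigr do under eq_bigr do rewrite !sum_cos_constant //.
rewrite sumr_const card_ord sumr_const card_ord -mulrnA -[X in X - _]mulr_natr natrM -expr2.
by rewrite subrr normr0.
Qed.

Definition wave (p q t : R) k := p * cos (t *+ k) + q * sin (t *+ k).

(** A product of three cosines is a quarter of the sum of four cosines of signed sums of the
    arguments, which are affine in [n] and [m]. *)
Lemma quadratic_growth_cos3 t1 t2 t3 w1 w2 w3 : quadratic_growth (fun N =>
  trisum N (fun k => cos (t1 *+ k + w1)) (fun k => cos (t2 *+ k + w2))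
           (fun k => cos (t3 *+ k + w3))).
Proof.
pose F u v w N := \sum_(n < N) \sum_(m < N) cos (u *+ n + (v *+ m + w) : R).
have E N : trisum N (fun k => cos (t1 *+ k + w1)) (fun k => cos (t2 *+ k + w2))
           (fun k => cos (t3 *+ k + w3)) =
  4^-1 * (F (t1 + t3) (t2 + t3) (w1 + w2 + w3) N +
          F (t1 - t3) (t2 - t3) (w1 + w2 - w3) N +
         (F (t1 + t3) (- t2 + t3) (w1 - w2 + w3) N +
          F (- t1 + t3) (t2 + t3) (- w1 + w2 + w3) N)).
  rewrite /F -!big_split /= /trisum mulr_sumr; apply: eq_bigr => n _.
  rewrite -!big_split /= mulr_sumr; apply: eq_bigr => m _ /=.
  pose x : R := t1 *+ n + w1; pose y := t2 *+ m + w2; pose z := t3 *+ (n + m) + w3.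
  have -> : (t1 + t3) *+ n + ((t2 + t3) *+ m + (w1 + w2 + w3)) = x + y + z.
    by rewrite /x /y /z mulrnDr !mulrnDl; ring.
  have -> : (t1 - t3) *+ n + ((t2 - t3) *+ m + (w1 + w2 - w3)) = x + y - z.
    by rewrite /x /y /z mulrnDr !mulrnDl !mulNrn; ring.
  have -> : (t1 + t3) *+ n + ((- t2 + t3) *+ m + (w1 - w2 + w3)) = x - y + z.
    by rewrite /x /y /z mulrnDr !mulrnDl !mulNrn; ring.
  have -> : (- t1 + t3) *+ n + ((t2 + t3) *+ m + (- w1 + w2 + w3)) = y - x + z.
    by rewrite /x /y /z mulrnDr !mulrnDl !mulNrn; ring.
  rewrite -/x -/y -/z !(cosD, sinD, cosN, sinN).
  move: (cos x) (sin x) (cos y) (sin y) (cos z) (sin z) => cx sx cy sy cz sz; lra.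
under [X in quadratic_growth X]funext do rewrite E.
apply: quadratic_growthZ.
apply: (@quadratic_growthD (fun N => F _ _ _ N + F _ _ _ N)
  (fun N => F _ _ _ N + F _ _ _ N)); apply: quadratic_growthD;
exact: quadratic_growth_cos.
Qed.

Lemma waveE p q t : wave p q t =
  (fun k => p * cos (t *+ k + 0)) \+ (fun k => q * cos (t *+ k + - (pi / 2))).
Proof. by apply/funext => k /=; rewrite addr0 cosBpihalf. Qed.

Lemma quadratic_growth_wave p q t p' q' t' p'' q'' t'' :
  quadratic_growth (fun N =>
    trisum N (wave p q t) (wave p' q' t') (wave p'' q'' t'')).
Proof.
rewrite !waveE.
under [X in quadratic_growth X]funext do
  rewrite !(trisumDl, trisumDm, trisumDr) !trisumZ3.
by do 3! (apply: quadratic_growthD); apply: quadratic_growthZ;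
  exact: quadratic_growth_cos3.
Qed.

(** Amplitudes and frequencies range over compact sets, which gives the limits in [trigsum_ultra].
    Amplitudes up to 1 suffice, since fits are improved by waves of amplitude [e <= 1]. *)
Fixpoint trigsum J s : Prop :=
  if J is J'.+1 then exists s' (p q t : R), [/\ trigsum J' s', p ^+ 2 + q ^+ 2 <= 1,
    0 <= t <= pi *+ 2 & s = s' \+ wave p q t]
  else s = cst 0.

Lemma quadratic_growth_trigsum J K L a b c :
  trigsum J a -> trigsum K b -> trigsum L c ->
  quadratic_growth (fun N => trisum N a b c).
Proof.
have zero u : (forall N, u N = 0) -> quadratic_growth u.
  by move=> u0; exists 0, 0 => N; rewrite u0 !mul0r subrr normr0.
move=> sa sb sc; elim: J a sa => [|J IHJ] a /=.
  move=> ->; apply: zero => N; rewrite /trisum big1 // => n _.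
  by rewrite big1 // => m _; rewrite !mul0r.
move=> [a' [p [q [t [sa _ _ ->]]]]].
under [X in quadratic_growth X]funext do rewrite trisumDl.
apply: quadratic_growthD; first exact: IHJ.
elim: K b sb {IHJ} => [|K IHK] b /=.
  move=> ->; apply: zero => N; rewrite /trisum big1 // => n _.
  by rewrite big1 // => m _; rewrite mulr0 mul0r.
move=> [b' [p' [q' [t' [sb _ _ ->]]]]].
under [X in quadratic_growth X]funext do rewrite trisumDm.
apply: quadratic_growthD; first exact: IHK.
elim: L c sc {IHK} => [|L IHL] c /=.
  move=> ->; apply: zero => N; rewrite /trisum big1 // => n _.
  by rewrite big1 // => m _; rewrite mulr0.
move=> [c' [p'' [q'' [t'' [sc _ _ ->]]]]].
under [X in quadratic_growth X]funext do rewrite trisumDr.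
apply: quadratic_growthD; first exact: IHL.
exact: quadratic_growth_wave.
Qed.

Lemma quadratic_growth_cvg u : quadratic_growth u -> exists l : R,
  forall e, 0 < e -> exists N0, forall N, (N0 <= N)%N -> `|u N / N%:R ^+ 2 - l| <= e.
Proof.
move=> [l [C H]]; exists l => e e0.
exists (Num.bound `|C / e|).+1 => N NN.
have N0 : 0 < N%:R :> R by rewrite ltr0n (leq_trans _ NN).
have CN : C <= e * N%:R.
  rewrite -ler_pdivrMl // mulrC (le_trans (ler_norm _)) //.
  by rewrite (le_trans (ltW (archi_boundP _))) // ler_nat (leq_trans _ NN).
have N2 : 0 < N%:R ^+ 2 :> R by rewrite exprn_gt0.
have -> : u N / N%:R ^+ 2 - l = (u N - l * N%:R ^+ 2) / N%:R ^+ 2.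
  by rewrite mulrBl mulfK ?gt_eqF.
rewrite normrM normfV (gtr0_norm N2) ler_pdivrMr // (le_trans (H N)) //.
by rewrite expr2 mulrA ler_wpM2r // ltW.
Qed.

Lemma energy_ge0 N a : 0 <= energy N a.
Proof. by apply: sumr_ge0 => k _; exact: sqr_ge0. Qed.

Lemma energy_approx N a s : energy N s <= 2 * energy N (a \- s) + 2 * energy N a.
Proof.
rewrite !mulr_sumr -big_split; apply: ler_sum => k _ /=.
by have := sqr_ge0 (2 * a k - s k); nra.
Qed.

(** The three sequences are replaced one at a time; at each step the remainder with small
    coefficients occupies one slot and the others enter through their energies. *)
Lemma trisum_approx N (a b c s1 s2 s3 : nat -> R) (e : R) : (0 < N)%N -> 0 <= e ->
  energy N a <= N%:R -> energy N b <= N%:R -> energy N.*2 c <= N.*2%:R ->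
  energy N (a \- s1) <= 2 * N%:R -> energy N (b \- s2) <= 2 * N%:R ->
  energy N.*2 (c \- s3) <= 2 * N.*2%:R ->
  small_coef N (a \- s1) (e * N%:R) -> small_coef N (b \- s2) (e * N%:R) ->
  small_coef N.*2 (c \- s3) (e * N.*2%:R) ->
  `|trisum N a b c - trisum N s1 s2 s3| <= 35 * e * N%:R ^+ 2.
Proof.
move=> N0 e0 ea eb ec da db dc ua ub uc.
have -> : trisum N a b c - trisum N s1 s2 s3 = trisum N (a \- s1) b c +
   trisum N s1 (b \- s2) c + trisum N s1 s2 (c \- s3).
  have D a1 a2 : a1 = (a1 \- a2) \+ a2 :> (nat -> R).
    by apply/funext => k /=; rewrite subrK.
  have := trisumDl N (a \- s1) s1 b c; have := trisumDm N s1 (b \- s2) s2 c.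
  have := trisumDr N s1 s2 (c \- s3) s3; rewrite -!D => -> -> ->.
  by rewrite !addrA addrK.
have es1 := energy_approx N a s1; have es2 := energy_approx N b s2.
have H1 := trisum_le1 b c N0 ua; have H2 := trisum_le2 s1 c N0 ub.
have H3 := trisum_le3 s1 s2 N0 uc.
rewrite (le_trans (ler_normD _ _)) // (le_trans (lerD (ler_normD _ _) (lexx _))) //.
rewrite (le_trans (lerD (lerD H1 H2) H3)) //.
have NN : N.*2%:R = 2 * N%:R :> R by rewrite -muln2 natrM mulrC.
rewrite NN in ec dc *.
(* [energy_approx] bounds the energies of [s1] and [s2] by 6N, so the three errors are 3, 8 and 24
   times [e N ^ 2]. *)
rewrite (_ : 35 * e * N%:R ^+ 2 =
  e * N%:R * (3 * N%:R) + e * N%:R * (8 * N%:R) + e * (2 * N%:R) * (12 * N%:R)).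
  by rewrite !lerD // ler_wpM2l ?mulr_ge0 //; lra.
by ring.
Qed.

End TrigSums.

(** * Distance of a word to trigonometric sums *)

Section Defect.
Variable R : realType.
Implicit Types (s : nat -> R) (t : R) (N M J : nat) (w : nat -> bool).

Lemma wave0 t : wave 0 0 t = cst 0 :> (nat -> R).
Proof. by apply/funext => k; rewrite /wave !mul0r addr0. Qed.

Lemma trigsumS J s : trigsum J s -> trigsum J.+1 s.
Proof.
move=> sJ; exists s, 0, 0, 0; split => //.
- by rewrite expr0n addr0 ler01.
- by rewrite lexx mulrn_wge0 // pi_ge0.
- by rewrite wave0; apply/funext => k /=; rewrite addr0.
Qed.

Lemma trigsum_zero J : trigsum J (cst 0 : nat -> R).
Proof. by elim: J => // J /trigsumS. Qed.

(** A shift by [i] rotates each amplitude vector (p, q) by the angle [t i], which preserves its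
    norm. *)
Lemma trigsum_shift J s i : trigsum J s -> trigsum J (fun k => s (i + k)%N).
Proof.
elim: J s => [|J IH] s /=; first by move->.
move=> [s' [p [q [t [sJ pq t2 ->]]]]].
exists (fun k => s' (i + k)%N), (p * cos (t *+ i) + q * sin (t *+ i)),
  (q * cos (t *+ i) - p * sin (t *+ i)), t.
split => //; first exact: IH.
- apply: le_trans pq; rewrite le_eqVlt; apply/orP; left; apply/eqP.
  rewrite -[RHS]mulr1 -(cos2Dsin2 (t *+ i)); ring.
- apply/funext => k /=; congr (_ + _).
  by rewrite /wave mulrnDr cosD sinD; ring.
Qed.

Definition word_seq w : nat -> R := fun k => (w k)%:R.
Definition dist2 N w s := energy N (word_seq w \- s).
Definition defect J N w := inf [set dist2 N w s | s in trigsum J].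

Lemma defect_has_inf J N w : has_inf [set dist2 N w s | s in trigsum J].
Proof.
split; first by exists (dist2 N w (cst 0)), (cst 0) => //; exact: trigsum_zero.
by exists 0 => _ [s _ <-]; exact: energy_ge0.
Qed.

Lemma defect_le J N w s : trigsum J s -> defect J N w <= dist2 N w s.
Proof. by move=> sJ; apply: ge_inf; [case: (defect_has_inf J N w)|exists s]. Qed.

Lemma defect_ge J N w x : (forall s, trigsum J s -> x <= dist2 N w s) ->
  x <= defect J N w.
Proof.
move=> H; apply: lb_le_inf; first by case: (defect_has_inf J N w).
by move=> _ [s sJ <-]; exact: H.
Qed.

Lemma defect_approx J N w e : 0 < e ->
  exists2 s, trigsum J s & dist2 N w s <= defect J N w + e.
Proof.
move=> e0; have [_ [s sJ <-] /ltW] := inf_adherent e0 (defect_has_inf J N w).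
by exists s.
Qed.

Lemma defect_ge0 J N w : 0 <= defect J N w.
Proof. by apply: defect_ge => s _; exact: energy_ge0. Qed.

Lemma energy_word N w : energy N (word_seq w) <= N%:R.
Proof.
rewrite -[X in _ <= X%:R]card_ord -sumr_const; apply: ler_sum => k _.
by rewrite /word_seq; case: (w k); rewrite ?expr0n ?expr1n ?ler01.
Qed.

Lemma defect_leN J N w : defect J N w <= N%:R.
Proof.
apply: le_trans (defect_le N w (trigsum_zero J)) _.
apply: le_trans (energy_word N w).
by apply: ler_sum => k _ /=; rewrite subr0.
Qed.

Lemma defectS J N w : defect J.+1 N w <= defect J N w.
Proof. by apply: defect_ge => s /trigsumS; exact: defect_le. Qed.

Lemma energyD N M (a : nat -> R) :
  energy (N + M) a = energy N a + energy M (fun k => a (N + k)%N).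
Proof. by rewrite /energy big_split_ord. Qed.

(** Any fit on the long interval restricts to both pieces, and the restriction to the second one is
    a shifted trigonometric sum. *)
Lemma defectD J N M w :
  defect J N w + defect J M (fun k => w (N + k)%N) <= defect J (N + M) w.
Proof.
apply: defect_ge => s sJ; rewrite /dist2 energyD lerD ?defect_le //.
exact: (defect_le M _ (trigsum_shift N sJ)).
Qed.

(* [F w] depends only on the first [N] letters of [w]. *)
Definition local (V : Type) N (F : (nat -> bool) -> V) :=
  forall w w', (forall k, (k < N)%N -> w k = w' k) -> F w = F w'.

Lemma local_dist2 N M s : (N <= M)%N -> local M (fun w => dist2 N w s).
Proof.
move=> NM w w' E; apply: eq_bigr => k _; rewrite /word_seq /= E //.
exact: leq_trans NM.
Qed.

Lemma local_defect J N M : (N <= M)%N -> local M (defect J N).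
Proof.
move=> NM w w' E; congr inf; apply/seteqP; split => _ [s sJ <-]; exists s => //.
  by rewrite (local_dist2 s NM E).
by rewrite (local_dist2 s NM E).
Qed.

(* A large Fourier coefficient of [w - s] could be used to improve the fit by
   adding one wave to [s]. *)
Lemma small_coef_defect J N w s (e : R) : trigsum J s -> 0 < e <= 1 ->
  dist2 N w s <= defect J.+1 N w + e ^+ 2 * N%:R ->
  small_coef N (word_seq w \- s) (e * N%:R).
Proof.
move=> sJ /andP[e0 e1] H t t2; set u := word_seq w \- s.
(* Adding the wave changes the squared distance by its energy, at most [e ^ 2 N], minus twice its
   inner product with [u]; near optimality of [s] then bounds this product. The pairs (e, 0), (-e,
   0), (0, e), (0, -e) isolate the coefficients. *)
have key p q : p ^+ 2 + q ^+ 2 = e ^+ 2 ->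
    p * cos_coef N u t + q * sin_coef N u t <= e ^+ 2 * N%:R.
  move=> pq.
  have sJ' : trigsum J.+1 (s \+ wave p q t).
    by exists s, p, q, t; split => //; rewrite pq expr_le1 // ltW.
  have wN : energy N (wave p q t) <= e ^+ 2 * N%:R.
    rewrite mulr_natr -[X in _ *+ X]card_ord -sumr_const.
    apply: ler_sum => k _; rewrite -pq /wave.
    have c2 := cos2Dsin2 (t *+ k); move: (cos _) (sin _) c2 => c d c2.
    have -> : p ^+ 2 + q ^+ 2 = (p ^+ 2 + q ^+ 2) * (c ^+ 2 + d ^+ 2).
      by rewrite c2 mulr1.
    by have := sqr_ge0 (p * d - q * c); nra.
  have := le_trans H (lerD (defect_le N w sJ') (lexx _)).
  have -> : dist2 N w (s \+ wave p q t) = dist2 N w s -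
     2 * (p * cos_coef N u t + q * sin_coef N u t) + energy N (wave p q t).
    rewrite /dist2 /energy /cos_coef /sin_coef !mulr_sumr -big_split mulr_sumr.
    rewrite -sumrB -big_split; apply: eq_bigr => k _ /=; rewrite /u /wave /=; ring.
  lra.
have norm_le x : e * x <= e ^+ 2 * N%:R -> - e * x <= e ^+ 2 * N%:R ->
    `|x| <= e * N%:R.
  by rewrite mulNr -mulrN expr2 -mulrA !ler_pM2l // ler_norml lerNl => -> ->.
split; apply: norm_le.
- by have := key e 0; rewrite expr0n mul0r !addr0; apply.
- by have := key (- e) 0; rewrite expr0n mul0r !addr0 sqrrN; apply.
- by have := key 0 e; rewrite expr0n mul0r !add0r; apply.
- by have := key 0 (- e); rewrite expr0n mul0r !add0r sqrrN; apply.
Qed.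

Lemma ultra_cvg_itv (U : set_system nat) (u : nat -> R) (a b : R) :
  UltraFilter U -> (forall n, a <= u n <= b) ->
  exists2 l, a <= l <= b & u @ U --> l.
Proof.
move=> UU H; have /(_ (u @ U) _)[|l [lab cl]] := @segment_compact R a b.
  by rewrite /fmap /=; apply: filterE => n; rewrite /= in_itv /= H.
exists l; first by move: lab; rewrite /= in_itv /=.
move=> A Al; have [//|nA] := in_ultra_setVsetC (u @^-1` A) UU.
by have [x [nAx Ax]] := cl (~` A) A nA Al; case: nAx.
Qed.

(** Along an ultrafilter all bounded parameters converge at once, so no subsequences are extracted
    in the induction; a wave depends continuously on its parameters at each [k]. *)
Lemma trigsum_ultra (U : set_system nat) J (s : nat -> nat -> R) :
  UltraFilter U -> (forall n, trigsum J (s n)) ->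
  exists2 l, trigsum J l & forall k, s n k @[n --> U] --> l k.
Proof.
move=> UU; elim: J s => [|J IH] s sJ /=.
  exists (cst 0) => // k.
  by rewrite (_ : (fun n => s n k) = cst 0); [exact: cvg_cst|apply/funext => n; rewrite sJ].
have /choice[s' /choice[p /choice[q /choice[t H]]]] := sJ.
have [l' l'J s'l] := IH s' (fun n => let: And4 h _ _ _ := H n in h).
have b1 (x y : R) : x ^+ 2 + y ^+ 2 <= 1 -> -1 <= x <= 1 /\ -1 <= y <= 1.
  have sqr_le1 (z : R) : z ^+ 2 <= 1 -> -1 <= z <= 1.
    by move=> z1; apply/andP; split; nra.
  by move=> xy; split; apply: sqr_le1; have := sqr_ge0 x; have := sqr_ge0 y; lra.
have [lp _ plp] := ultra_cvg_itv UU (fun n => let: And4 _ h _ _ := H n in (b1 _ _ h).1).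
have [lq _ qlq] := ultra_cvg_itv UU (fun n => let: And4 _ h _ _ := H n in (b1 _ _ h).2).
have [lt lt2 tlt] := ultra_cvg_itv UU (fun n => let: And4 _ _ h _ := H n in h).
have cvg_mulrn k : t n *+ k @[n --> U] --> lt *+ k.
  rewrite (_ : (fun n => t n *+ k) = (fun n => t n * k%:R)).
    by rewrite -[lt *+ k]mulr_natr; apply: (cvgM tlt); exact: cvg_cst.
  by apply/funext => n; rewrite mulr_natr.
exists (l' \+ wave lp lq lt).
  exists l', lp, lq, lt; split => //.
  have : p n ^+ 2 + q n ^+ 2 @[n --> U] --> lp ^+ 2 + lq ^+ 2.
    by apply: cvgD; [exact: (cvgM plp plp)|exact: (cvgM qlq qlq)].
  apply: (@closed_cvg _ _ U _ _ [set x : R | x <= 1]) => //.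
  by apply: nearW => n; have [] := H n.
move=> k; rewrite (_ : (fun n => s n k) =
    (fun n => s' n k + (p n * cos (t n *+ k) + q n * sin (t n *+ k)))); last first.
  by apply/funext => n; have [_ _ _ ->] := H n.
apply: cvgD => //; apply: cvgD; apply: cvgM => //.
  by apply: continuous_cvg => //; exact: continuous_cos.
by apply: continuous_cvg => //; exact: continuous_sin.
Qed.

End Defect.

(** * Superadditivity and windows *)

Section Windows.
Variable R : realType.
Implicit Types (s : nat -> R) (N M J L K : nat) (w : nat -> bool).

(** Fekete's lemma: the rate is the supremum of [u N / N], hence the upper bound for every N and the
    lower bound for large N only. *)
Lemma superadditive_rate (u : nat -> R) :
  (forall N, 0 <= u N <= N%:R) -> (forall N M, u N + u M <= u (N + M)%N) ->
  exists r, [/\ 0 <= r <= 1, forall N, u N <= r * N%:R &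
    forall k, 0 < k -> exists h, forall N, (h <= N)%N -> (r - k) * N%:R <= u N].
Proof.
move=> u01 uD; pose E := [set u N / N%:R | N in [set N | (0 < N)%N]].
have E1 x : E x -> 0 <= x <= 1.
  move=> [N /= N0 <-]; have /andP[u0 uN] := u01 N.
  by rewrite divr_ge0 //= ler_pdivrMr ?ltr0n // mul1r.
have supE : has_sup E.
  split; first by exists (u 1%N / 1%:R), 1%N.
  by exists 1 => x /E1/andP[].
have ub : ubound E (sup E) := sup_upper_bound supE.
exists (sup E); split.
- apply/andP; split.
    have E1' : E (u 1%N / 1%:R) by exists 1%N.
    by have /andP[h _] := E1 _ E1'; exact: le_trans h (ub _ E1').
  by apply: ge_sup => //; [exact: supE.1 | move=> x /E1/andP[]].
- case=> [|N]; first by have /andP[_] := u01 0%N; rewrite mulr0.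
  by rewrite -ler_pdivrMr ?ltr0n //; apply: ub; exists N.+1.
move=> k k0; have k20 : 0 < k / 2 by rewrite divr_gt0.
have [_ [N N0 <-] HN] := sup_adherent k20 supE.
have N0' : 0 < N%:R :> R by rewrite ltr0n.
set r := sup E in HN *.
have r1 : r <= 1 by apply: ge_sup => //; [exact: supE.1 | move=> x /E1/andP[]].
have uN : (r - k / 2) * N%:R <= u N by rewrite -ler_pdivlMr // ltW.
have umul q : q%:R * u N <= u (q * N)%N.
  elim: q => [|q IH]; first by rewrite mul0r; have /andP[] := u01 (0 * N)%N.
  by rewrite mulSn (le_trans _ (uD _ _)) // -natr1 mulrDl mul1r addrC lerD.
(* Beyond [b] one has [N <= k M / 2], so the remainder of [M] modulo [N] costs at most [k M / 2], as
   [r <= 1]. *)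
pose b := Num.bound (2 * N%:R / k); exists b => M bM.
have kM : 2 * N%:R <= k * M%:R.
  rewrite -ler_pdivrMl // mulrC; apply: (@le_trans _ _ b%:R).
    by apply/ltW/archi_boundP; rewrite divr_ge0 ?ltW // mulr_gt0.
  by rewrite ler_nat.
have uM : (M %/ N)%:R * u N <= u M.
  rewrite (le_trans (umul _)) // {2}(divn_eq M N).
  rewrite (le_trans _ (uD _ _)) // lerDl.
  by have /andP[] := u01 (M %% N)%N.
have qM : M%:R <= (M %/ N)%:R * N%:R + N%:R :> R.
  rewrite {1}(divn_eq M N) natrD natrM lerD2l ler_nat ltnW // ltn_pmod //.
have /andP[u0 _] := u01 N.
have q0 : 0 <= (M %/ N)%:R :> R by [].
have qN : (M %/ N)%:R * N%:R <= M%:R :> R by rewrite -natrM ler_nat leq_trunc_div.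
set q : R := (M %/ N)%:R in uM qM q0 qN.
have : q * ((r - k / 2) * N%:R) <= u M by rewrite (le_trans _ uM) // ler_wpM2l.
apply: le_trans; rewrite mulrCA.
(* The product [q N] lies between [M - N] and [M]; the sign of the factor decides which end is
   used. *)
have [rk|rk] := leP 0 (r - k / 2); last first.
  apply: (@le_trans _ _ ((r - k / 2) * M%:R)).
    by rewrite ler_wpM2r // lerD2l lerN2; lra.
  by rewrite ler_wnM2l // ltW.
apply: (@le_trans _ _ ((r - k / 2) * (M%:R - N%:R))).
  by nra.
by rewrite ler_wpM2l //; lra.
Qed.

Lemma energy_mono N M (a : nat -> R) : (N <= M)%N -> energy N a <= energy M a.
Proof. by move=> /subnKC <-; rewrite energyD lerDl energy_ge0. Qed.

(** Each index belongs to at most N windows: for a fixed position in the window the starting points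
    give distinct indices. *)
Lemma sum_energy_windows L N M (a : nat -> R) : (L + N <= M)%N ->
  \sum_(i < L) energy N (fun k => a (i + k)%N) <= N%:R * energy M a.
Proof.
move=> LNM; rewrite exchange_big /= mulr_natl -[X in _ *+ X]card_ord -sumr_const.
apply: ler_sum => k _.
rewrite (eq_bigr (fun i : 'I_L => a (k + i)%N ^+ 2)) => [|i _]; last by rewrite addnC.
apply: (@le_trans _ _ (energy (k + L) a)); first by rewrite energyD lerDr energy_ge0.
by apply: energy_mono; rewrite (leq_trans _ LNM) // addnC leq_add2l ltnW.
Qed.

(** The scales are cut at [K] so that the property depends on finitely many letters and is
    measurable along orbits. *)
Definition well_fitted J (Ns : nat -> nat) (eta : R) K w := exists2 s, trigsum J s &
  forall j, (j < K)%N -> dist2 (Ns j) w s <= defect R J (Ns j) w + eta * (Ns j)%:R.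

(* A nearly optimal fit [s] on [0, M) restricts to a fit of every window
   [i, i + Ns j), and the excesses over the optimal fits of these windows are
   nonnegative, so Markov's inequality bounds the number of bad windows. *)
Lemma sum_not_well_fitted J Ns eta K w L M :
  0 < eta -> (forall j, 0 < Ns j)%N -> (forall j, (j < K)%N -> (L + Ns j <= M)%N) ->
  eta * \sum_(i < L) (~~ `[< well_fitted J Ns eta K (fun k => w (i + k)%N) >])%:R <=
  \sum_(j < K) (defect R J M w + 1 -
     (\sum_(i < L) defect R J (Ns j) (fun k => w (i + k)%N)) / (Ns j)%:R).
Proof.
(* The slack 1 does not grow with [L], so it is negligible once many windows are averaged. *)
move=> eta0 Ns0 LM; have [s sJ sM] := defect_approx J M w (@ltr01 R).
pose excess i j := (dist2 (Ns j) (fun k => w (i + k)%N) (fun k => s (i + k)%N) -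
   defect R J (Ns j) (fun k => w (i + k)%N)) / (Ns j)%:R.
have NsR j : 0 < (Ns j)%:R :> R by rewrite ltr0n.
have excess_ge0 i j : 0 <= excess i j.
  by rewrite divr_ge0 // subr_ge0; apply: defect_le; exact: trigsum_shift.
apply: (@le_trans _ _ (\sum_(i < L) \sum_(j < K) excess i j)).
  rewrite mulr_sumr; apply: ler_sum => i _.
  case: asboolP => [_|nfit]; first by rewrite mulr0 sumr_ge0.
  rewrite mulr1; apply: contrapT => /negP; rewrite -ltNge => lt_eta; apply: nfit.
  exists (fun k => s (i + k)%N); first exact: trigsum_shift.
  move=> j jK; rewrite -lerBlDl -ler_pdivrMr // (le_trans _ (ltW lt_eta)) //.
  by rewrite (bigD1 (Ordinal jK)) //= lerDl sumr_ge0.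
rewrite exchange_big; apply: ler_sum => j _ /=.
rewrite -mulr_suml sumrB mulrBl lerD2r ler_pdivrMr // mulrC.
apply: le_trans (ler_wpM2l (ltW (NsR j)) sM).
exact: (sum_energy_windows (word_seq R w \- s) (LM j (ltn_ord j))).
Qed.

Lemma local_well_fitted J Ns eta K N :
  (forall j, (j < K)%N -> (Ns j <= N)%N) -> local N (well_fitted J Ns eta K).
Proof.
move=> NsN w w' E; apply/propext; split => -[s sJ H]; exists s => // j jK.
  by rewrite -(local_dist2 s (NsN j jK) E) -(local_defect R J (NsN j jK) E) H.
by rewrite (local_dist2 s (NsN j jK) E) (local_defect R J (NsN j jK) E) H.
Qed.

(** The inequality at scale [j] is closed and holds for the sums chosen for all [K > j], so it
    passes to their limit along an ultrafilter finer than [\oo]. *)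
Lemma well_fitted_limit J Ns eta w :
  (forall K, well_fitted J Ns eta K w) -> exists2 s, trigsum J s &
  forall j, dist2 (Ns j) w s <= defect R J (Ns j) w + eta * (Ns j)%:R.
Proof.
move=> /(fun H => choice (fun K => let: ex_intro2 s sJ H' := H K in
  ex_intro (fun s => trigsum J s /\ forall j, (j < K)%N ->
    dist2 (Ns j) w s <= defect R J (Ns j) w + eta * (Ns j)%:R) s (conj sJ H'))) [s H].
have [U [UU sub]] := ultraFilterLemma (_ : ProperFilter \oo).
have [l lJ sl] := trigsum_ultra UU (fun n => (H n).1).
exists l => // j.
pose b := defect R J (Ns j) w + eta * (Ns j)%:R.
apply: (@closed_cvg _ _ U _ (fun n => dist2 (Ns j) w (s n)) [set x : R | x <= b]).
- exact: (@closed_le R b).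
- apply: sub; exists j.+1 => // n /= jn; exact: (H n).2.
rewrite /dist2 /energy.
apply: (@cvg_big _ _ +%R) => [|k _]; first exact: add_continuous.
have d : (word_seq R w \- s n) k @[n --> U] --> (word_seq R w \- l) k.
  by apply: cvgB => //; exact: cvg_cst.
exact: (cvgM d d).
Qed.

End Windows.

(** * Means of bounded measurable functions *)

Section Mean.
Variables (R : realType) (d : measure_display) (X : measurableType d).
Variable mu : probability X R.
Implicit Types (f g : X -> R) (T : X -> X) (A : set X).

Definition bounded_measurable f :=
  measurable_fun setT f /\ exists C : R, forall x, `|f x| <= C.

Definition mean f : R := \int[mu]_x f x.

Lemma bounded_measurable_integrable f :
  bounded_measurable f -> mu.-integrable setT (EFin \o f).
Proof.
move=> [mf [C fC]]; apply: measurable_bounded_integrable => //.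
- exact: (le_lt_trans (probability_le1 mu measurableT) (ltry _)).
- exists C; split; first exact: num_real.
  by move=> y Cy x _; exact: le_trans (fC x) (ltW Cy).
Qed.

Lemma bounded_measurableD f g : bounded_measurable f -> bounded_measurable g ->
  bounded_measurable (f \+ g).
Proof.
move=> [mf [C fC]] [mg [C' gC]]; split; first exact: measurable_funD.
by exists (C + C') => x; rewrite (le_trans (ler_normD _ _)) ?lerD.
Qed.

Lemma bounded_measurableM f g : bounded_measurable f -> bounded_measurable g ->
  bounded_measurable (f \* g).
Proof.
move=> [mf [C fC]] [mg [C' gC]]; split; first exact: measurable_funM.
by exists (C * C') => x; rewrite normrM ler_pM.
Qed.

Lemma bounded_measurable_cst (c : R) : bounded_measurable (cst c).
Proof. by split; [exact: measurable_cst|exists `|c|]. Qed.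

Lemma bounded_measurableN f : bounded_measurable f ->
  bounded_measurable (\- f).
Proof.
move=> [mf [C fC]]; split; first exact: measurableT_comp.
by exists C => x; rewrite normrN.
Qed.

Lemma bounded_measurable_sum n (F : nat -> X -> R) :
  (forall i, bounded_measurable (F i)) ->
  bounded_measurable (fun x => \sum_(i < n) F i x).
Proof.
move=> H; elim: n => [|n IH].
  under [X in bounded_measurable X]funext do rewrite big_ord0.
  exact: bounded_measurable_cst.
under [X in bounded_measurable X]funext do rewrite big_ord_recr.
exact: bounded_measurableD.
Qed.

Lemma bounded_measurable_indic A : measurable A -> bounded_measurable (\1_A).
Proof.
move=> mA; split; first exact: measurable_indic.
by exists 1 => x; rewrite indicE; case: (x \in A); rewrite ?normr0 ?normr1 ?ler01.
Qed.

Lemma meanD f g : bounded_measurable f -> bounded_measurable g ->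
  mean (f \+ g) = mean f + mean g.
Proof.
by move=> ? ?; apply: RintegralD => //; exact: bounded_measurable_integrable.
Qed.

Lemma meanZ c f : bounded_measurable f -> mean (fun x => c * f x) = c * mean f.
Proof.
by move=> ?; apply: RintegralZl => //; exact: bounded_measurable_integrable.
Qed.

Lemma mean_cst c : mean (cst c) = c.
Proof.
transitivity (c * fine (mu setT)); first exact: Rintegral_cst.
by rewrite probability_setT mulr1.
Qed.

Lemma meanB f g : bounded_measurable f -> bounded_measurable g ->
  mean (f \- g) = mean f - mean g.
Proof.
by move=> ? ?; apply: RintegralB => //; exact: bounded_measurable_integrable.
Qed.

Lemma mean_sum n (F : nat -> X -> R) : (forall i, bounded_measurable (F i)) ->
  mean (fun x => \sum_(i < n) F i x) = \sum_(i < n) mean (F i).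
Proof.
move=> H; elim: n => [|n IH].
  under [X in mean X]funext do rewrite big_ord0.
  by rewrite big_ord0; exact: mean_cst.
under [X in mean X]funext do rewrite big_ord_recr /=.
rewrite big_ord_recr /= -IH; apply: meanD => //.
exact: bounded_measurable_sum.
Qed.

Lemma mean_le f g : bounded_measurable f -> bounded_measurable g ->
  (forall x, f x <= g x) -> mean f <= mean g.
Proof.
by move=> ? ? fg; apply: le_Rintegral => //; exact: bounded_measurable_integrable.
Qed.

Lemma mean_indic A : measurable A -> mean (\1_A) = fine (mu A).
Proof. by move=> mA; rewrite /mean /Rintegral integral_indic // setIT. Qed.

Lemma bounded_measurable_comp f T : measure_preserving mu T ->
  bounded_measurable f -> bounded_measurable (f \o T).
Proof.
move=> [mT _] [mf [C fC]]; split; first exact: measurableT_comp.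
by exists C => x; exact: fC.
Qed.

Lemma mean_comp f T : measure_preserving mu T -> bounded_measurable f ->
  mean (f \o T) = mean f.
Proof.
move=> mpT bf; have [mf _] := bf; have [mT pT] := mpT.
have bfT := bounded_measurable_integrable (bounded_measurable_comp mpT bf).
rewrite /mean /Rintegral; congr fine.
have mEf : measurable_fun setT (EFin \o f) by exact/measurable_EFinP.
rewrite -(integral_pushforward (D := setT) mT mEf bfT measurableT).
by apply: eq_measure_integral => A mA _; exact: pT.
Qed.

Lemma measurable_superlevel f (c : R) :
  measurable_fun setT f -> measurable [set x | c < f x].
Proof.
move=> mf; rewrite -[X in measurable X]setTI.
rewrite (_ : [set x | _] = f @^-1` `]c, +oo[%classic); first exact: mf.
by apply/seteqP; split => x /=; rewrite in_itv /= andbT.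
Qed.

Lemma measure_preserving_iter T n : measure_preserving mu T ->
  measure_preserving mu (iter n T).
Proof.
move=> mpT; elim: n => [|n [mn pn]]; first by split => //; exact: measurable_id.
have [mT pT] := mpT; split; first exact: (measurableT_comp mT mn).
move=> A mA; rewrite -[RHS]pT // -[RHS]pn //.
by rewrite -[X in measurable X]setTI; exact: mT.
Qed.

End Mean.

(** * Orbit words *)

Section Structure.
Variables (R : realType) (d : measure_display) (X : measurableType d).
Variable mu : probability X R.
Variables (T : X -> X) (A : set X).
Hypotheses (mpT : measure_preserving mu T) (mA : measurable A).

Definition orbit_word (x : X) : nat -> bool := fun k => iter k T x \in A.

Lemma orbit_word_iter i x :
  orbit_word (iter i T x) = (fun k => orbit_word x (i + k)%N).
Proof. by apply/funext => k; rewrite /orbit_word addnC iterD. Qed.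

Lemma measurable_orbit_letter k : measurable [set x | orbit_word x k].
Proof.
rewrite (_ : [set x | _] = iter k T @^-1` A).
  by rewrite -[X in measurable X]setTI; apply: (measure_preserving_iter k mpT).1.
by apply/seteqP; split => x; rewrite /orbit_word /= inE.
Qed.

(** Finitely many letters take finitely many values, so [Q] may be arbitrary. This makes infima and
    existential statements over all trigonometric sums measurable. *)
Lemma measurable_local_set N (Q : (nat -> bool) -> Prop) :
  local N Q -> measurable [set x | Q (orbit_word x)].
Proof.
elim: N Q => [|N IH] Q lQ.
  have [Q0|Q0] := pselect (Q (fun=> false)).
    rewrite (_ : [set x | _] = setT) //; apply/seteqP; split => // x _ /=.
    by rewrite (lQ _ (fun=> false)).
  rewrite (_ : [set x | _] = set0) //; apply/seteqP; split => // x /=.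
  by rewrite (lQ _ (fun=> false)).
(* Freezing letter [N] leaves a predicate of the first [N] letters. *)
pose upd b (w : nat -> bool) k := if k == N then b else w k.
have lupd b : local N (Q \o upd b).
  move=> w w' E; apply: lQ => k; rewrite ltnS leq_eqVlt /upd.
  by case: eqP => //= _ /E.
have updK w : upd (w N) w = w by apply/funext => k; rewrite /upd; case: eqP => // ->.
have mN := measurable_orbit_letter N.
rewrite (_ : [set x | _] =
   ([set x | orbit_word x N] `&` [set x | Q (upd true (orbit_word x))]) `|`
   (~` [set x | orbit_word x N] `&` [set x | Q (upd false (orbit_word x))])).
  apply: measurableU; apply: measurableI => //; [exact: (IH _ (lupd true)) |
    exact: measurableC | exact: (IH _ (lupd false))].
apply/seteqP; split => x /=; have := updK (orbit_word x).
  by case: (orbit_word x N) => ->; [left|right].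
by case: (orbit_word x N) => -> [[]|[]].
Qed.

Lemma bounded_measurable_local N (F : (nat -> bool) -> R) (C : R) :
  local N F -> (forall w, `|F w| <= C) -> bounded_measurable (F \o orbit_word).
Proof.
move=> lF FC; split; last by exists C => x; exact: FC.
move=> _ B mB; rewrite setTI; apply: (@measurable_local_set N (F @^-1` B)).
by move=> w w' /lF /= ->.
Qed.

Lemma bounded_measurable_defect J N :
  bounded_measurable (fun x => defect R J N (orbit_word x)).
Proof.
apply: (@bounded_measurable_local N (defect R J N) N%:R).
  exact: local_defect.
by move=> w; rewrite ger0_norm ?defect_ge0 ?defect_leN.
Qed.

Definition mean_defect J N := mean mu (fun x => defect R J N (orbit_word x)).

Lemma mean_defect_shift J N i :
  mean mu (fun x => defect R J N (fun k => orbit_word x (i + k)%N)) =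
  mean_defect J N.
Proof.
rewrite /mean_defect -(mean_comp (measure_preserving_iter i mpT)
  (bounded_measurable_defect J N)).
by congr mean; apply/funext => x /=; rewrite orbit_word_iter.
Qed.

Lemma bounded_measurable_defect_shift J N i :
  bounded_measurable (fun x => defect R J N (fun k => orbit_word x (i + k)%N)).
Proof.
under [X in bounded_measurable X]funext do rewrite -orbit_word_iter.
exact: (bounded_measurable_comp (measure_preserving_iter i mpT)
  (bounded_measurable_defect J N)).
Qed.

Lemma mean_defect_rate J : exists r, [/\ 0 <= r <= 1,
  forall N, mean_defect J N <= r * N%:R &
  forall k, 0 < k -> exists h, forall N, (h <= N)%N ->
    (r - k) * N%:R <= mean_defect J N].
Proof.
apply: superadditive_rate => [N|N M].
  have bd := bounded_measurable_defect J N.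
  apply/andP; split.
    rewrite -(mean_cst mu 0); apply: mean_le => // [|x]; last exact: defect_ge0.
    exact: bounded_measurable_cst.
  rewrite -(mean_cst mu N%:R); apply: mean_le => // [|x]; last exact: defect_leN.
  exact: bounded_measurable_cst.
rewrite -(mean_defect_shift J M N) -meanD.
- apply: mean_le.
  + by apply: bounded_measurableD; [exact: bounded_measurable_defect |
      exact: bounded_measurable_defect_shift].
  + exact: bounded_measurable_defect.
  + by move=> x; exact: defectD.
- exact: bounded_measurable_defect.
- exact: bounded_measurable_defect_shift.
Qed.

Lemma markov_mean f (c : R) : bounded_measurable f -> (forall x, 0 <= f x) ->
  c * fine (mu [set x | c < f x]) <= mean mu f.
Proof.
move=> bf f0; have m : measurable [set x | c < f x].
  exact: measurable_superlevel bf.1.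
rewrite -(mean_indic mu m) -meanZ; last exact: bounded_measurable_indic.
apply: mean_le => // [|x].
  apply: (@bounded_measurableM _ _ _ (cst c) (\1__)).
    exact: bounded_measurable_cst.
  exact: bounded_measurable_indic.
rewrite indicE; case: (boolP (x \in _)) => [|_]; last by rewrite mulr0.
by rewrite inE /= mulr1 => /ltW.
Qed.

(** The window estimate is integrated over [x]. By invariance each of the [L] windows contributes
    the same measure, while the right side is at most [L] times the sum of the [k j] plus a
    constant. *)
Lemma measure_not_well_fitted J (Ns : nat -> nat) (eta r : R) (k : nat -> R) K :
  0 < eta -> (forall j, 0 < Ns j)%N -> 0 <= r ->
  (forall N, mean_defect J N <= r * N%:R) ->
  (forall j, (r - k j) * (Ns j)%:R <= mean_defect J (Ns j)) ->
  eta * fine (mu [set x | ~ well_fitted J Ns eta K (orbit_word x)]) <=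
  \sum_(j < K) k j.
Proof.
move=> eta0 Ns0 r0 mr mk.
pose P := (\sum_(j < K) Ns j)%N.
have NsP j : (j < K)%N -> (Ns j <= P)%N.
  by move=> jK; rewrite /P (bigD1 (Ordinal jK)) //= leq_addr.
set B := [set x | _].
have lB : local P (fun w => ~ well_fitted J Ns eta K w).
  by move=> w w' /(local_well_fitted J eta NsP) ->.
have mB : measurable B := measurable_local_set lB.
(* The long interval has length [L + P]: the surplus [P] costs [r P] and the nearly optimal fit
   costs 1, for each scale. *)
pose C := \sum_(j < K) (r * P%:R + 1).
have key (L : nat) : L%:R * (eta * fine (mu B) - \sum_(j < K) k j) <= C.
  pose b : X -> R := \1_B.
  have bb : bounded_measurable b := bounded_measurable_indic R mB.
  pose lhs x := eta * \sum_(i < L) (b \o iter i T) x.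
  pose G (j : nat) x := defect R J (L + P) (orbit_word x) + 1 -
    (Ns j)%:R^-1 * (\sum_(i < L) defect R J (Ns j) (fun k => orbit_word x (i + k)%N)).
  pose rhs x := \sum_(j < K) G j x.
  have bB i : bounded_measurable (b \o iter i T).
    exact: (bounded_measurable_comp (measure_preserving_iter i mpT)
       bb).
  have bS : bounded_measurable (fun x => \sum_(i < L) (b \o iter i T) x : R).
    exact: (@bounded_measurable_sum _ _ _ L (fun i => b \o iter i T) bB).
  have bD j : bounded_measurable (fun x =>
     \sum_(i < L) defect R J (Ns j) (fun k => orbit_word x (i + k)%N)).
    apply: (@bounded_measurable_sum _ _ _ L
      (fun i x => defect R J (Ns j) (fun k => orbit_word x (i + k)%N))) => i.
    exact: bounded_measurable_defect_shift.
  have bD1 : bounded_measurable (fun x => defect R J (L + P) (orbit_word x) + 1).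
    apply: (bounded_measurableD (bounded_measurable_defect _ _)).
    exact: bounded_measurable_cst.
  have bDZ j : bounded_measurable (fun x => (Ns j)%:R^-1 *
     \sum_(i < L) defect R J (Ns j) (fun k => orbit_word x (i + k)%N)).
    exact: (bounded_measurableM (bounded_measurable_cst _ _) (bD j)).
  have bG j : bounded_measurable (G j).
    exact: (bounded_measurableD bD1 (bounded_measurableN (bDZ j))).
  have : mean mu lhs <= mean mu rhs.
    apply: mean_le.
    - exact: (bounded_measurableM (bounded_measurable_cst _ _) bS).
    - exact: (@bounded_measurable_sum _ _ _ K G bG).
    - move=> x.
      have /(_ L (L + P)%N) := @sum_not_well_fitted R J Ns eta K (orbit_word x) _ _ eta0 Ns0.
      move=> H; apply: le_trans (le_trans (H _) _).
      + rewrite /lhs ler_pM2l //; apply: ler_sum => i _ /=.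
        rewrite /b indicE -orbit_word_iter; case: (boolP (_ \in B)).
          by rewrite inE => /asboolPn ->.
        by [].
      + by move=> j jK; rewrite leq_add2l NsP.
      + by apply: ler_sum => j _; rewrite [X in _ - X]mulrC.
  rewrite /lhs (meanZ mu _ bS) (@mean_sum _ _ _ mu L (fun i => b \o iter i T)) //.
  rewrite (eq_bigr (fun=> fine (mu B))) => [|i _]; last first.
    rewrite (mean_comp (measure_preserving_iter i mpT) bb).
    exact: (mean_indic mu mB).
  rewrite sumr_const card_ord /rhs.
  rewrite (@mean_sum _ _ _ mu K G bG).
  rewrite -[fine (mu B) *+ L]mulr_natl mulrCA mulrBr lerBlDr => /le_trans; apply.
  rewrite mulr_sumr -big_split; apply: ler_sum => j _ /=.
  have -> : mean mu (G j) = mean_defect J (L + P) + 1 -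
      (Ns j)%:R^-1 * (mean_defect J (Ns j) *+ L).
    rewrite (meanB mu bD1 (bDZ j) : mean mu (G j) = _) (meanZ mu _ (bD j)).
    rewrite (meanD mu (bounded_measurable_defect _ _) (bounded_measurable_cst _ 1)).
    rewrite mean_cst (@mean_sum _ _ _ mu L
      (fun i x => defect R J (Ns j) (fun k => orbit_word x (i + k)%N))).
      under eq_bigr do rewrite mean_defect_shift.
      by rewrite sumr_const card_ord.
    by move=> i; exact: bounded_measurable_defect_shift.
  have h1 := mr (L + P)%N; have h2 := mk j.
  have Nj : 0 < (Ns j)%:R :> R by rewrite ltr0n.
  have h3 : (r - k j) <= (Ns j)%:R^-1 * mean_defect J (Ns j).
    by rewrite mulrC ler_pdivlMr.
  rewrite -[mean_defect J (Ns j) *+ L]mulr_natl mulrCA.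
  have := ler_wpM2l (ler0n R L) h3; rewrite natrD in h1 => h4.
  by lra.
(* Otherwise the factor of [L] in [key] is positive and a large [L] exceeds [C]. *)
have [//|lt_k] := leP (eta * fine (mu B)) (\sum_(j < K) k j).
have g0 : 0 < eta * fine (mu B) - \sum_(j < K) k j by rewrite subr_gt0.
have := key (Num.bound (C / (eta * fine (mu B) - \sum_(j < K) k j))).
have C0 : 0 <= C by apply: sumr_ge0 => j _; rewrite addr_ge0 // mulr_ge0.
have := archi_boundP (divr_ge0 C0 (ltW g0)).
by rewrite ltr_pdivrMr // => /lt_le_trans h /h; rewrite ltxx.
Qed.

End Structure.

(** * One trigonometric sum for all good scales of an orbit *)

Section Structure.
Variables (R : realType) (d : measure_display) (X : measurableType d).
Variable mu : probability X R.
Variables (T : X -> X) (A : set X).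
Hypotheses (mpT : measure_preserving mu T) (mA : measurable A).

Lemma fine_measureU_le (B C D : set X) : measurable B -> measurable C ->
  measurable D -> D `<=` B `|` C -> fine (mu D) <= fine (mu B) + fine (mu C).
Proof.
move=> mB mC mD sub.
have fin E : measurable E -> mu E \is a fin_num by move=> mE; exact: fin_num_measure.
rewrite -fineD ?fin // fine_le ?fin ?fin_numD ?fin //.
apply: le_trans (measureU2 _ _ _) => //.
by apply: le_measure => //; rewrite inE //; exact: measurableU.
Qed.

Lemma sum_half_le K : \sum_(j < K) (2^-1 : R) ^+ j.+1 <= 1.
Proof.
suff -> : \sum_(j < K) (2^-1 : R) ^+ j.+1 = 1 - 2^-1 ^+ K.
  by rewrite gerBl exprn_ge0 // invr_ge0.
elim: K => [|K IH]; first by rewrite big_ord0 expr0 subrr.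
by rewrite big_ord_recr /= IH exprS; lra.
Qed.

(** Drops all larger than [k] would push [r] below 0 after about [1 / k] steps. *)
Lemma small_drop (r : nat -> R) (k : R) : 0 < k -> (forall J, 0 <= r J <= 1) ->
  exists J, r J - r J.+1 <= k.
Proof.
move=> k0 r01; apply: contrapT => nJ.
have drop J : r J.+1 < r J - k.
  by rewrite ltrBrDl -ltrBrDr ltNge; apply/negP => h; apply: nJ; exists J.
have rJ J : r J <= 1 - k * J%:R.
  elim: J => [|J IH]; first by rewrite mulr0 subr0; have /andP[] := r01 0%N.
  by rewrite (le_trans (ltW (drop J))) // -natr1; lra.
have kV : 0 <= k^-1 by rewrite invr_ge0 ltW.
have := archi_boundP kV; set b := Num.bound _ => lt_b.
have : 1 < k * b%:R by rewrite -ltr_pdivrMl // mulr1.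
by have := rJ b; have /andP[] := r01 b; lra.
Qed.

(* The exceptional sets depend on the scale, but [s] does not. *)
Lemma orbit_structure (e : R) : 0 < e <= 1 -> exists J (h : nat -> nat),
  forall Ns : nat -> nat, (forall i, (h i <= Ns i)%N) ->
  exists G : nat -> set X,
  [/\ forall i, measurable (G i),
      forall i, fine (mu (~` G i)) <= e &
      forall x, (forall n, exists2 i, (n <= i)%N & G i x) ->
      exists2 s, trigsum J s & forall i, G i x ->
        dist2 (Ns i) (orbit_word T A x) s <= 2 * (Ns i)%:R /\
        small_coef (Ns i) (word_seq R (orbit_word T A x) \- s) (e * (Ns i)%:R)].
Proof.
move=> /andP[e0 e1].
have /choice[r hr] := mean_defect_rate mpT mA.
(* One [eta N] is the excess of the fit and another the gain from one more wave; together they make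
   the [e ^ 2 N] allowed in [small_coef_defect]. *)
pose eta := e ^+ 2 / 2.
have eta0 : 0 < eta by rewrite divr_gt0 // exprn_gt0.
have eta1 : eta <= 1 
  by have e21 : e ^+ 2 <= 1; [rewrite expr_le1 // ltW | rewrite /eta; lra].
(* The mean gain from one more wave will be at most [2 k1 N], so Markov's inequality at the level
   [eta N] leaves measure at most [e / 2]. *)
pose k1 := eta * e / 4; have k10 : 0 < k1 by rewrite !(divr_gt0, mulr_gt0).
have [J rJ] : exists J, r J - r J.+1 <= k1 by apply: small_drop => // J; case: (hr J).
(* These tolerances sum to at most [eta e / 2] over any number of scales, which leaves the other
   [e / 2] for badly fitted points. *)
pose k j := eta * e / 2 * 2^-1 ^+ j.+1.
have k0 j : 0 < k j by rewrite !(mulr_gt0, divr_gt0) // exprn_gt0.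
have [/andP[r0 _] mr hJ] := hr J.
have [h hh] := choice (fun j => hJ _ (k0 j)).
have [_ _ /(_ _ k10)[h' hh']] := hr J.+1.
exists J, (fun i => maxn (maxn (h i) h') 1%N) => Ns hNs.
have Ns0 j : (0 < Ns j)%N by rewrite (leq_trans _ (hNs j)) // leq_max orbT.
have Ns1 j : (h j <= Ns j)%N by rewrite (leq_trans _ (hNs j)) // leq_max leq_maxl.
have Ns2 j : (h' <= Ns j)%N.
  by rewrite (leq_trans _ (hNs j)) // leq_max leq_maxr.
pose P i := (\sum_(j < i.+1) Ns j)%N.
have NsP i j : (j < i.+1)%N -> (Ns j <= P i)%N.
  by move=> ji; rewrite /P (bigD1 (Ordinal ji)) //= leq_addr.
pose W i := [set x | well_fitted J Ns eta i.+1 (orbit_word T A x)].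
pose D i x := defect R J (Ns i) (orbit_word T A x) - defect R J.+1 (Ns i) (orbit_word T A x).
pose E i := [set x | eta * (Ns i)%:R < D i x].
have mW i : measurable (W i).
  exact: (measurable_local_set mpT mA (local_well_fitted J eta (NsP i))).
have bd J' i := bounded_measurable_defect mpT mA J' (Ns i).
have bD i : bounded_measurable (D i).
  exact: (bounded_measurableD (bd J i) (bounded_measurableN (bd J.+1 i))).
have mE i : measurable (E i).
  exact: measurable_superlevel (bD i).1.
exists (fun i => W i `&` ~` E i); split.
- by move=> i; apply: measurableI => //; exact: measurableC.
- move=> i; apply: le_trans (@fine_measureU_le (~` W i) (E i) _ _ _ _ _) _ => //.
  + exact: measurableC.
  + by apply: measurableC; apply: measurableI => //; exact: measurableC.
  + by rewrite setCI setCK.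
  have h1 := measure_not_well_fitted mpT mA i.+1 eta0 Ns0 r0 mr (fun j => hh j _ (Ns1 j)).
  have h2 : eta * e / 2 * \sum_(j < i.+1) 2^-1 ^+ j.+1 <= eta * (e / 2).
    by rewrite -[X in _ <= X]mulr1 mulrA ler_wpM2l ?sum_half_le // ltW // divr_gt0 // mulr_gt0.
  have h3 : fine (mu (~` W i)) <= e / 2.
    by rewrite -(ler_pM2l eta0) (le_trans h1) // -mulr_sumr.
  have Nsi : 0 < (Ns i)%:R :> R by rewrite ltr0n.
  have h4 : eta * (Ns i)%:R * fine (mu (E i)) <= mean mu (D i).
    by apply: (markov_mean mu _ (bD i)) => x; rewrite subr_ge0 defectS.
  have h5 : mean mu (D i) <= 2 * k1 * (Ns i)%:R.
    rewrite (meanB mu (bd J i) (bd J.+1 i) : mean mu (D i) = _).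
    have := mr (Ns i); have := hh' _ (Ns2 i); rewrite /mean_defect => a b.
    have := ler_wpM2r (ltW Nsi) rJ; lra.
  have h6 : fine (mu (E i)) <= e / 2.
    have en : 0 < eta * (Ns i)%:R by rewrite mulr_gt0.
    rewrite -(ler_pM2l en) (le_trans h4) // (le_trans h5) // /k1; lra.
  lra.
move=> x Gx.
(* A point in infinitely many [G i] is well fitted at the first [K] scales for every [K]; the limit
   sum is then nearly optimal at all scales, and [E i] matters only for its Fourier coefficients. *)
have [K|s sJ fit] := @well_fitted_limit R J Ns eta (orbit_word T A x).
  have [i Ki [[s sJ H] _]] := Gx K; exists s => // j jK; apply: H.
  by rewrite ltnS (leq_trans (ltnW jK)).
exists s => // i [_ /negP]; rewrite -leNgt => DE.
have fi := fit i; split.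
  rewrite (le_trans fi) // mulrDl mul1r lerD ?defect_leN //.
  by rewrite -[X in _ <= X]mul1r ler_wpM2r.
apply: (small_coef_defect sJ); first by rewrite e0.
by move: DE fi; rewrite /D /eta; lra.
Qed.

End Structure.

(** * Averages of non-commuting transformations *)

Section CubicAverages.
Variables (R : realType) (d : measure_display) (X : measurableType d).
Variable mu : probability X R.

(** The tail unions decrease and have measure at least [c]; continuity from above gives their
    intersection positive measure. *)
Lemma limsup_nonempty (V : nat -> set X) (c : R) : 0 < c ->
  (forall i, measurable (V i)) -> (forall i, c <= fine (mu (V i))) ->
  exists x, forall n, exists2 i, (n <= i)%N & V i x.
Proof.
move=> c0 mV cV.
have mU n : measurable (\bigcup_(k in [set k | (n <= k)%N]) V k).
  by apply: bigcup_measurable.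
have lim : mu (\bigcup_(k in [set k | (n <= k)%N]) V k) @[n --> \oo] --> mu (lim_sup_set V).
  apply: lim_sup_set_cvg => //.
  exact: (le_lt_trans (probability_le1 mu (mU 0%N)) (ltry _)).
have cmu : (c%:E <= mu (lim_sup_set V))%E.
  rewrite -(cvg_lim _ lim) //; apply: lime_ge; first by apply/cvg_ex; eexists; exact: lim.
  apply: nearW => n; apply: (@le_trans _ _ (mu (V n))).
    by rewrite -[mu (V n)]fineK ?lee_fin // fin_num_measure.
  apply: le_measure; [by rewrite inE|by rewrite inE|].
  by move=> x Vx; exists n => /=.
have [x Vx] : lim_sup_set V !=set0.
  apply/set0P; apply: contraTneq cmu => ->.
  by rewrite measure0 lee_fin -ltNge.
by exists x => n; have [i ni Vi] := Vx n I; exists i.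
Qed.

Lemma fine_measureI_ge (B G : set X) (a e : R) : measurable B -> measurable G ->
  a <= fine (mu B) -> fine (mu (~` G)) <= e -> a - e <= fine (mu (B `&` G)).
Proof.
move=> mB mG aB Ge; rewrite lerBlDr (le_trans aB) //.
apply: le_trans (lerD (lexx _) Ge); apply: fine_measureU_le => //.
- exact: measurableI.
- exact: measurableC.
- by move=> x Bx; have [Gx|Gx] := pselect (G x); [left|right].
Qed.

Variables (T1 T2 T3 : X -> X) (A : set X).
Hypotheses (mp1 : measure_preserving mu T1) (mp2 : measure_preserving mu T2)
  (mp3 : measure_preserving mu T3) (mA : measurable A).

(* Orbits are read from time 1 for [T1] and [T2], and from time 2 for [T3], so that
   all the sequences are indexed from 0. *)
Let A1 := T1 @^-1` A.
Let A2 := T2 @^-1` A.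
Let A3 := iter 2 T3 @^-1` A.
Let w1 x := word_seq R (orbit_word T1 A1 x).
Let w2 x := word_seq R (orbit_word T2 A2 x).
Let w3 x := word_seq R (orbit_word T3 A3 x).

Lemma measurable_preimage T (B : set X) : measure_preserving mu T ->
  measurable B -> measurable (T @^-1` B).
Proof. by move=> [mT _] mB; rewrite -[X in measurable X]setTI; exact: mT. Qed.

Definition cubic_average (N : nat) (x : X) : R :=
  (N%:R ^+ 2)^-1 * trisum N (w1 x) (w2 x) (w3 x).

Lemma bounded_measurable_word T B k : measure_preserving mu T -> measurable B ->
  bounded_measurable (fun x => word_seq R (orbit_word T B x) k).
Proof.
move=> mpT mB; rewrite (_ : (fun x => _) = \1_[set x | orbit_word T B x k]).
  by apply: bounded_measurable_indic; exact: measurable_orbit_letter mpT mB k.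
by apply/funext => x; rewrite indicE /word_seq mem_setE.
Qed.

Lemma bounded_measurable_cubic_average N : bounded_measurable (cubic_average N).
Proof.
apply: (bounded_measurableM (bounded_measurable_cst _ _)).
apply: (@bounded_measurable_sum _ _ _ N
  (fun n x => \sum_(m < N) w1 x n * w2 x m * w3 x (n + m)%N)) => n.
apply: (@bounded_measurable_sum _ _ _ N
  (fun m x => w1 x n * w2 x m * w3 x (n + m)%N)) => m.
have m1 := measurable_preimage mp1 mA; have m2 := measurable_preimage mp2 mA.
have m3 := measurable_preimage (measure_preserving_iter 2 mp3) mA.
exact: (bounded_measurableM (bounded_measurableM (bounded_measurable_word n mp1 m1)
  (bounded_measurable_word m mp2 m2)) (bounded_measurable_word (n + m) mp3 m3)).
Qed.

Definition return_average (N : nat) : R := (N%:R ^+ 2)^-1 *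
  \sum_(1 <= n < N.+1) \sum_(1 <= m < N.+1)
    fine (mu (A `&` (iter n T1 @^-1` A) `&` (iter m T2 @^-1` A)
                `&` (iter (n + m) T3 @^-1` A))).

Lemma return_averageE N :
  return_average N = mean mu (fun x => \1_A x * cubic_average N x).
Proof.
pose S n m : set X := A `&` (iter n.+1 T1 @^-1` A) `&` (iter m.+1 T2 @^-1` A)
                `&` (iter (n.+1 + m.+1) T3 @^-1` A).
have mS n m : measurable (S n m).
  by apply: measurableI; [apply: measurableI; [apply: measurableI|]|] => //;
    apply: measurable_preimage => //; exact: measure_preserving_iter.
have SE n m x : \1_(S n m) x = \1_A x * (w1 x n * w2 x m * w3 x (n + m)%N) :> R.
  rewrite !indicE /S addSn addnS !in_setI.
  rewrite /w1 /w2 /w3 /word_seq /orbit_word.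
  (* The last step of each orbit, or the last two for [T3], is absorbed into the target set, which
     shifts the indices to start at 0. *)
  change (x \in iter n.+1 T1 @^-1` A) with (iter n T1 x \in A1).
  change (x \in iter m.+1 T2 @^-1` A) with (iter m T2 x \in A2).
  change (x \in iter (n + m).+2 T3 @^-1` A) with (iter (n + m) T3 x \in A3).
  by rewrite -!natrM !mulnb !andbA.
have bS n m : bounded_measurable (\1_(S n m) : X -> R).
  exact: bounded_measurable_indic.
have bSn n : bounded_measurable (fun x => \sum_(m < N) \1_(S n m) x : R).
  exact: (@bounded_measurable_sum _ _ _ N (fun m => \1_(S n m)) (bS n)).
have -> : (fun x => \1_A x * cubic_average N x) = (fun x => (N%:R ^+ 2)^-1 *
    \sum_(n < N) \sum_(m < N) \1_(S n m) x).
  apply/funext => x; rewrite /cubic_average mulrCA; congr (_ * _).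
  rewrite /trisum mulr_sumr; apply: eq_bigr => n _.
  by rewrite mulr_sumr; apply: eq_bigr => m _; rewrite SE.
rewrite meanZ; last exact: (@bounded_measurable_sum _ _ _ N
  (fun n x => \sum_(m < N) \1_(S n m) x) bSn).
rewrite (@mean_sum _ _ _ mu N (fun n x => \sum_(m < N) \1_(S n m) x) bSn).
rewrite /return_average big_add1 big_mkord; congr (_ * _); apply: eq_bigr => n _.
rewrite (@mean_sum _ _ _ mu N (fun m => \1_(S n m)) (bS n)).
rewrite big_add1 big_mkord; apply: eq_bigr => m _.
by rewrite mean_indic.
Qed.

Lemma cubic_average_approx x N e s1 s2 s3 : (0 < N)%N -> 0 < e ->
  dist2 N (orbit_word T1 A1 x) s1 <= 2 * N%:R /\ small_coef N (w1 x \- s1) (e * N%:R) ->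
  dist2 N (orbit_word T2 A2 x) s2 <= 2 * N%:R /\ small_coef N (w2 x \- s2) (e * N%:R) ->
  dist2 N.*2 (orbit_word T3 A3 x) s3 <= 2 * N.*2%:R /\
    small_coef N.*2 (w3 x \- s3) (e * N.*2%:R) ->
  `|cubic_average N x - trisum N s1 s2 s3 / N%:R ^+ 2| <= 35 * e.
Proof.
move=> N0 e0 [d1 c1] [d2 c2] [d3 c3].
have N2 : 0 < N%:R ^+ 2 :> R by rewrite exprn_gt0 // ltr0n.
rewrite /cubic_average mulrC -mulrBl normrM normfV (gtr0_norm N2) ler_pdivrMr //.
by apply: trisum_approx => //; rewrite ?energy_word // ltW.
Qed.

Lemma trisum_word_bounds N (u v z : nat -> bool) :
  0 <= trisum N (word_seq R u) (word_seq R v) (word_seq R z) <= N%:R ^+ 2.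
Proof.
apply/andP; split.
  by apply: sumr_ge0 => n _; apply: sumr_ge0 => m _; rewrite !mulr_ge0 // ler0n.
rewrite expr2 mulr_natl -[X in _ *+ X]card_ord -sumr_const; apply: ler_sum => n _.
rewrite -[X in _ <= X%:R]card_ord -sumr_const; apply: ler_sum => m _.
by rewrite /word_seq -!natrM !mulnb; case: (_ && _).
Qed.

Lemma cubic_average_bounds N x : (0 < N)%N -> 0 <= cubic_average N x <= 1.
Proof.
move=> N0; have N2 : 0 < N%:R ^+ 2 :> R by rewrite exprn_gt0 // ltr0n.
have /andP[t0 t1] := trisum_word_bounds N (orbit_word T1 A1 x)
  (orbit_word T2 A2 x) (orbit_word T3 A3 x).
rewrite /cubic_average mulrC; apply/andP; split.
  exact: (divr_ge0 t0 (ltW N2)).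
by rewrite ler_pdivrMr // mul1r.
Qed.

Lemma measurable_cubic_gap M N (c : R) :
  measurable [set x | c < `|cubic_average M x - cubic_average N x|].
Proof.
apply: (@measurable_superlevel _ _ _
  (fun x => `|cubic_average M x - cubic_average N x|)).
have [mB _] := bounded_measurableD (bounded_measurable_cubic_average M)
  (bounded_measurableN (bounded_measurable_cubic_average N)).
by apply: (measurableT_comp _ mB) => //; exact: measurable_normr.
Qed.

(** The pointwise averages lie in [0, 1], so they differ by at most 1 on the exceptional set and by
    at most [c] off it. *)
Lemma return_average_dist M N (c : R) : (0 < M)%N -> (0 < N)%N -> 0 <= c ->
  `|return_average M - return_average N| <=
  c + fine (mu [set x | c < `|cubic_average M x - cubic_average N x|]).
Proof.
move=> M0 N0 c0; set D := [set x | _].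
have bM := bounded_measurable_cubic_average M.
have bN := bounded_measurable_cubic_average N.
have mD : measurable D := measurable_cubic_gap M N c.
have bA : bounded_measurable (\1_A : X -> R) := bounded_measurable_indic R mA.
have bAM K : bounded_measurable (fun x => \1_A x * cubic_average K x).
  exact: (bounded_measurableM bA (bounded_measurable_cubic_average K)).
have bD : bounded_measurable (\1_D : X -> R) := bounded_measurable_indic R mD.
have bc := bounded_measurable_cst X c.
have pt x : `|\1_A x * cubic_average M x - \1_A x * cubic_average N x| <= c + \1_D x.
  rewrite -mulrBr normrM.
  have /andP[m0 m1] := cubic_average_bounds x M0.
  have /andP[n0 n1] := cubic_average_bounds x N0.
  have le : `|cubic_average M x - cubic_average N x| <= c + \1_D x.
    rewrite [\1_D x]indicE; case: (boolP (x \in D)) => xD.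
      by rewrite (@le_trans _ _ 1) ?lerDr // ler_norml; apply/andP; split; lra.
    by rewrite addr0 leNgt; apply: contra xD => ?; rewrite inE.
  apply: le_trans le; rewrite [\1_A x]indicE.
  by case: (x \in A); rewrite ?normr1 ?mul1r // normr0 mul0r.
rewrite !return_averageE -(meanB mu (bAM M) (bAM N)).
have -> : c + fine (mu D) = mean mu (cst c \+ \1_D).
  by rewrite meanD // mean_cst mean_indic.
have bcD := bounded_measurableD bc bD.
have bMN := bounded_measurableD (bAM M) (bounded_measurableN (bAM N)).
rewrite ler_norml; apply/andP; split; last first.
  by apply: mean_le => // x; apply: le_trans (pt x); exact: ler_norm.
rewrite lerNl -mulN1r -meanZ //; apply: mean_le => // [|x].
  exact: (bounded_measurableM (bounded_measurable_cst _ _) bMN).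
by rewrite mulN1r; apply: le_trans (pt x); rewrite -normrN; exact: ler_norm.
Qed.

End CubicAverages.

(** * Convergence of the averages *)

Section Convergence.
Variables (R : realType) (d : measure_display) (X : measurableType d).
Variable mu : probability X R.
Variables (T1 T2 T3 : X -> X) (A : set X).
Hypotheses (mp1 : measure_preserving mu T1) (mp2 : measure_preserving mu T2)
  (mp3 : measure_preserving mu T3) (mA : measurable A).

Lemma return_average_cauchy (eps : R) : 0 < eps -> exists N0, forall M N,
  (N0 <= M)%N -> (N0 <= N)%N ->
  `|return_average mu T1 T2 T3 A M - return_average mu T1 T2 T3 A N| <= eps.
Proof.
move=> eps0; apply: contrapT => ncauchy.
have osc N0 : exists p : nat * nat, [/\ (N0 <= p.1)%N, (N0 <= p.2)%N &
    eps < `|return_average mu T1 T2 T3 A p.1 - return_average mu T1 T2 T3 A p.2|].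
  apply: contrapT => nex; apply: ncauchy; exists N0 => M N NM NN.
  by rewrite leNgt; apply/negP => h; apply: nex; exists (M, N).
have eps500 : 0 < eps / 500%:R by rewrite divr_gt0 ?ltr0n.
(* With [e <= eps / 500], removing six sets of measure at most [e] from measure [eps / 2] leaves
   [eps / 4], and [35 e + eps / 8 <= eps / 5]. Two averages within [eps / 5] of one limit cannot
   differ by more than [eps / 2]. *)
pose e := Num.min 1 (eps / 500%:R).
have e0 : 0 < e by rewrite lt_min ltr01 eps500.
have e1 : e <= 1 by rewrite ge_min lexx.
have e_eps : e * 500%:R <= eps by rewrite -ler_pdivlMr ?ltr0n // ge_min lexx orbT.
have e01 : 0 < e <= 1 by rewrite e0.
clearbody e.
have [J1 [h1 st1]] := orbit_structure mp1 (measurable_preimage mp1 mA) e01.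
have [J2 [h2 st2]] := orbit_structure mp2 (measurable_preimage mp2 mA) e01.
have [J3 [h3 st3]] := orbit_structure mp3
  (measurable_preimage (measure_preserving_iter 2 mp3) mA) e01.
pose h t := (h1 t + h2 t + h3 t)%N.
have [p hp] := choice (fun i => osc (h i.*2 + h i.*2.+1 + i.+1)%N).
(* Both scales of pair [i] enter one sequence, at the indices 2i and 2i + 1, so that the same
   trigonometric sum serves both. *)
pose Ns t := if odd t then (p t./2).2 else (p t./2).1.
have hNs t : (h t <= Ns t)%N.
  have hle (b : bool) k : (h (b + k.*2) <= h k.*2 + h k.*2.+1)%N.
    by case: b; rewrite ?add1n ?add0n ?leq_addl ?leq_addr.
  have [l1 l2 _] := hp t./2; have := hle (odd t) t./2; rewrite odd_double_half.
  move=> le_t; apply: leq_trans le_t (leq_trans (leq_addr (t./2).+1 _) _).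
  by rewrite /Ns; case: (odd t).
have [G1 [mG1 sG1 lG1]] := st1 Ns (fun t => leq_trans
  (leq_trans (leq_addr _ _) (leq_addr _ _)) (hNs t)).
have [G2 [mG2 sG2 lG2]] := st2 Ns (fun t => leq_trans
  (leq_trans (leq_addl _ _) (leq_addr _ _)) (hNs t)).
have hNs3 t : (h3 t <= (Ns t).*2)%N.
  by rewrite -addnn; apply: leq_trans (leq_addr _ _); exact: leq_trans (leq_addl _ _) (hNs t).
(* The third word is read at [n + m], hence on intervals of twice the length. *)
have [G3 [mG3 sG3 lG3]] := st3 (fun t => (Ns t).*2) hNs3.
pose D i := [set x | eps / 2 <
  `|cubic_average R T1 T2 T3 A (p i).1 x - cubic_average R T1 T2 T3 A (p i).2 x|].
have p0 i : (0 < (p i).1)%N /\ (0 < (p i).2)%N.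
  by have [l1 l2 _] := hp i; split; [apply: leq_trans l1|apply: leq_trans l2]; rewrite addnS.
have mD i : measurable (D i) := measurable_cubic_gap mp1 mp2 mp3 mA _ _ _.
have muD i : eps / 2 <= fine (mu (D i)).
  have [_ _ lt_eps] := hp i; have [M0 N0] := p0 i.
  have := return_average_dist mp1 mp2 mp3 mA M0 N0 (ltW (divr_gt0 eps0 (ltr0n R 2))).
  by rewrite -/(D i) => le; have := lt_le_trans lt_eps le; lra.
pose V i := D i `&` G1 i.*2 `&` G1 i.*2.+1 `&` G2 i.*2 `&` G2 i.*2.+1
  `&` G3 i.*2 `&` G3 i.*2.+1.
have mI (B C : set X) : measurable B -> measurable C -> measurable (B `&` C).
  exact: measurableI.
have mV i : measurable (V i) by do 6! (apply: (mI) => //).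
have muV i : eps / 4 <= fine (mu (V i)).
  have m1 := mI _ _ (mD i) (mG1 i.*2); have m2 := mI _ _ m1 (mG1 i.*2.+1).
  have m3 := mI _ _ m2 (mG2 i.*2); have m4 := mI _ _ m3 (mG2 i.*2.+1).
  have m5 := mI _ _ m4 (mG3 i.*2).
  have l1 := fine_measureI_ge (mD i) (mG1 i.*2) (muD i) (sG1 _).
  have l2 := fine_measureI_ge m1 (mG1 i.*2.+1) l1 (sG1 _).
  have l3 := fine_measureI_ge m2 (mG2 i.*2) l2 (sG2 _).
  have l4 := fine_measureI_ge m3 (mG2 i.*2.+1) l3 (sG2 _).
  have l5 := fine_measureI_ge m4 (mG3 i.*2) l4 (sG3 _).
  have l6 := fine_measureI_ge m5 (mG3 i.*2.+1) l5 (sG3 _).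
  by apply: le_trans l6; lra.
have [x Vx] := limsup_nonempty (divr_gt0 eps0 (ltr0n R 4)) mV muV.
(* Infinitely many even indices are enough to obtain the sum common to all scales. *)
have inf (G : nat -> set X) : (forall i, V i x -> G i.*2 x) ->
    forall n, exists2 i, (n <= i)%N & G i x.
  move=> VG n; have [i ni Vi] := Vx n; exists i.*2; last exact: VG.
  by rewrite -addnn (leq_trans ni) // leq_addr.
have [s1 sJ1 a1] := lG1 x (inf G1 (fun i H => H.1.1.1.1.1.2)).
have [s2 sJ2 a2] := lG2 x (inf G2 (fun i H => H.1.1.1.2)).
have [s3 sJ3 a3] := lG3 x (inf G3 (fun i H => H.1.2)).
have [l /(_ (eps / 8) (divr_gt0 eps0 (ltr0n R 8)))[N0 HN0]] :=
  quadratic_growth_cvg (quadratic_growth_trigsum sJ1 sJ2 sJ3).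
have [i Ni [[[[[[Di G1e] G1o] G2e] G2o] G3e] G3o]] := Vx N0.
have near_l t : (0 < Ns t)%N -> (N0 <= Ns t)%N -> G1 t x -> G2 t x -> G3 t x ->
    `|cubic_average R T1 T2 T3 A (Ns t) x - l| <= eps / 5.
  move=> Nt0 NtN0 g1 g2 g3.
  have := cubic_average_approx Nt0 e0 (a1 t g1) (a2 t g2) (a3 t g3).
  have := HN0 _ NtN0; rewrite !ler_norml => /andP[? ?] /andP[? ?].
  by apply/andP; split; lra.
have Nse : Ns i.*2 = (p i).1 by rewrite /Ns odd_double doubleK.
have Nso : Ns i.*2.+1 = (p i).2 by rewrite /Ns /= odd_double /= uphalf_double.
have [l1 l2 _] := hp i; have [pi1 pi2] := p0 i.
have N01 : (N0 <= (p i).1)%N.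
  by apply: leq_trans l1; rewrite addnS (leq_trans Ni) // ltnW // ltnS leq_addl.
have N02 : (N0 <= (p i).2)%N.
  by apply: leq_trans l2; rewrite addnS (leq_trans Ni) // ltnW // ltnS leq_addl.
have := near_l i.*2; rewrite Nse => /(_ pi1 N01 G1e G2e G3e).
have := near_l i.*2.+1; rewrite Nso => /(_ pi2 N02 G1o G2o G3o).
move: Di; rewrite /D /= ltNge => /negP nD.
rewrite !ler_norml => /andP[? ?] /andP[? ?]; apply: nD.
by rewrite ler_norml; apply/andP; split; lra.
Qed.

Lemma return_average_cvg : cvg (return_average mu T1 T2 T3 A @ \oo).
Proof.
apply: cauchy_cvg; apply: cauchy_exP => e e0.
have [N0 H] := return_average_cauchy (divr_gt0 e0 (ltr0n R 2)).
exists (return_average mu T1 T2 T3 A N0); exists N0 => // N /= NN.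
rewrite /ball_ /=; apply: le_lt_trans (H N0 N _ _) _ => //; lra.
Qed.


End Convergence.

(** * The lower bound when [A] is nearly the whole space *)

Theorem proposition6 (R : realType) (d : measure_display)
    (X : measurableType d) (mu : probability X R) :
  exists delta : R, 0 < delta < 1 /\
  forall T1 T2 T3 : X -> X,
    measure_preserving mu T1 ->
    measure_preserving mu T2 ->
    measure_preserving mu T3 ->
  forall A : set X, measurable A -> ((1 - delta)%:E < mu A)%E ->
  exists l : R,
    (fun N : nat =>
      (N%:R ^+ 2)^-1 *
      \sum_(1 <= n < N.+1) \sum_(1 <= m < N.+1)
        fine (mu (A `&` (iter n T1 @^-1` A) `&` (iter m T2 @^-1` A)
                    `&` (iter (n + m) T3 @^-1` A)))) @ \oo --> l /\
    1 / 2 * fine (mu A) ^+ 8 <= l.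
Proof.
(* Three preimages with complements of measure at most 1/8 cut a set of measure at least 7/8 down to
   no less than 1/2, while [mu(A) ^ 8 <= 1]. *)
exists (1 / 8); split; first by apply/andP; split; lra.
move=> T1 T2 T3 mp1 mp2 mp3 A mA muA.
have cv := return_average_cvg mp1 mp2 mp3 mA.
exists (lim (return_average mu T1 T2 T3 A @ \oo)); split; first exact: cv.
have [a0 a1 a78] : [/\ 0 <= fine (mu A), fine (mu A) <= 1 & 7 / 8 <= fine (mu A)].
  have fA : mu A \is a fin_num by exact: fin_num_measure.
  split; first by rewrite fine_ge0.
    by rewrite -lee_fin fineK //; exact: probability_le1.
  by rewrite -lee_fin fineK //; apply: le_trans (ltW muA); rewrite lee_fin; lra.
have a8 : fine (mu A) ^+ 8 <= 1 by exact: exprn_ile1.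
apply: (@le_trans _ _ (1 / 2)); first lra.
(* The average at N = 0 is an empty sum, equal to 0, so the bound starts at N = 1. *)
apply: limr_ge => //; exists 1%N => // N /= N0.
have N2 : 0 < N%:R ^+ 2 :> R by rewrite exprn_gt0 // ltr0n.
rewrite /return_average [X in _ <= X]mulrC ler_pdivlMr // mulrC.
rewrite big_add1 big_mkord expr2 -mulrA mulr_natl -[X in _ *+ X]card_ord -sumr_const.
apply: ler_sum => n _; rewrite big_add1 big_mkord.
rewrite mulr_natl -[X in _ *+ X]card_ord -sumr_const; apply: ler_sum => m _.
pose a := fine (mu A).
have pre T : measure_preserving mu T -> measurable (T @^-1` A) /\
    fine (mu (~` (T @^-1` A))) <= 1 / 8.
  move=> mpT; have mTA := measurable_preimage mpT mA; split => //.
  have [_ pT] := mpT; rewrite (probability_setC _ mTA) pT //.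
  by rewrite fineB ?fin_num_measure //=; lra.
have [m1 c1] := pre _ (measure_preserving_iter n.+1 mp1).
have [m2 c2] := pre _ (measure_preserving_iter m.+1 mp2).
have [m3 c3] := pre _ (measure_preserving_iter (n.+1 + m.+1) mp3).
have l1 := fine_measureI_ge mA m1 a78 c1.
have l2 := fine_measureI_ge (measurableI _ _ mA m1) m2 l1 c2.
have l3 := fine_measureI_ge (measurableI _ _ (measurableI _ _ mA m1) m2) m3 l2 c3.
by apply: le_trans l3; lra.
Qed.
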